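(* Assume that $\beta=(\beta_i^{(k)})$ with all $\beta_i^{(k)}>0$ satisfies $\sum_{i=1}^n\sum_{k=1}^{\ell_i} r_i^{(k)}\beta_i^{(k)}<1$, and let $\alpha,\sigma$ be determined by $\beta,\tau$ as in the context. If $(\mathbf x,\mathbf y)\in\mu_{\mathbb C}^{-1}(\tau)$ is $\beta$-stable, then the parabolic Higgs bundle $\mathcal T(\mathbf x,\mathbf y)=(E,\bar\partial_E,\mathcal F,\varphi)$ with parabolic weights $\alpha$ is $\alpha$-stable.
   Context: **Quiver data.** Fix $n\ge1$, $\ell_1,\dots,\ell_n\geq 1$, and positive integers $r_i^{(1)}<\dots<r_i^{(\ell_i)}<r_i^{(\ell_i+1)}:=r_\star$ ($i=1,\dots,n$); put $r_i^{(0)}=0$. (These are a star-shaped quiver $Q$ with central node $\star$, nodes $(i,k)$, arrows $(i,k)\to(i,k+1)$ where $(i,\ell_i+1)=\star$, and a branch-increasing dimension vector $\vec r$.) A point $(\mathbf x,\mathbf y)$ consists of linear maps $x_i^{(k)}:\mathbb C^{r_i^{(k)}}\to\mathbb C^{r_i^{(k+1)}}$ and $y_i^{(k)}:\mathbb C^{r_i^{(k+1)}}\to\mathbb C^{r_i^{(k)}}$, $1\le k\le\ell_i$, i.e. a representation of the doubled quiver $\tilde Q$. Set $x_i^{(0)}=0,y_i^{(0)}=0$, and $A_0=A-\frac{\mathrm{tr} A}{r_\star}\mathrm{Id}$ for $A\in\mathrm{End}(\mathbb C^{r_\star})$. For $\tau=(\tau_i^{(k)})$, $\tau_i^{(k)}\in\mathbb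 C$, the set $\mu_{\mathbb C}^{-1}(\tau)$ consists of $(\mathbf x,\mathbf y)$ with $\sum_{i}(x_i^{(\ell_i)}y_i^{(\ell_i)})_0=0$ and $y_i^{(k)}x_i^{(k)}-x_i^{(k-1)}y_i^{(k-1)}=\tau_i^{(k)}\mathrm{Id}$ for all $i$, $1\le k\le\ell_i$. **$\beta$-stability.** Put $\beta_\star=-\frac1{r_\star}\sum_{i,k}r_i^{(k)}\beta_i^{(k)}$. For a $\tilde Q$-representation $S$ with dimension vector $(s_\star,(s_i^{(k)}))$ put $\tilde\beta(S)=s_\star\beta_\star+\sum_{i,k}s_i^{(k)}\beta_i^{(k)}$. Then $(\mathbf x,\mathbf y)$ is $\beta$-stable if $\tilde\beta(S)<0$ for every nonzero proper $\tilde Q$-subrepresentation $S$. **Weights.** Put $m_i^{(k)}=r_i^{(k)}-r_i^{(k-1)}$, $1\le k\le\ell_i+1$. The real numbers $\alpha_i^{(k)}$ are determined by $\alpha_i^{(k)}-\alpha_i^{(k+1)}=\beta_i^{(k)}$ ($1\le k\le\ell_i$) and $\sum_{k=1}^{\ell_i+1}m_i^{(k)}\alpha_i^{(k)}=0$; the complex numbers $\sigma_i^{(k)}$ by $\sigma_i^{(k)}-\sigma_i^{(k+1)}=\tau_i^{(k)}$ and $\sum_{k=1}^{\ell_i+1}m_i^{(k)}\sigma_i^{(k)}=0$. By convention parabolic weights lie in $(-\frac12,\frac12)$, so $\beta$ is taken such that this holds. **The Higgs bundle $\mathcal T(\mathbf x,\mathbf y)$.** Let $D=\{p_1,\dots,p_n\}$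 be $n$ distinct points of $C=\mathbb{CP}^1$, with affine coordinate $z$ in which all $p_i$ are finite. Let $(E,\bar\partial_E)=\mathcal O^{\oplus r_\star}$ be the trivial holomorphic bundle on $C$. For $1\le k\le\ell_i$ let $X_i^{(k)}=x_i^{(\ell_i)}\circ\cdots\circ x_i^{(k)}$ and $F_i^{(k)}=\mathrm{im}\,X_i^{(k)}\subseteq E_{p_i}=\mathbb C^{r_\star}$; also $F_i^{(\ell_i+1)}=E_{p_i}$ and $F_i^{(0)}=0$. (If $(\mathbf x,\mathbf y)$ is $\beta$-stable all $x_i^{(k)}$ are injective, so $\dim F_i^{(k)}=r_i^{(k)}$.) The flags $\mathcal F=(F_i^{(\bullet)})$ with weights $\alpha_i^{(k)}$ attached to $F_i^{(k)}$ define a parabolic structure on $E$. The Higgs field is $\varphi=\sum_i\frac{\varphi_i\,dz}{z-p_i}$ with $\varphi_i=(x_i^{(\ell_i)}y_i^{(\ell_i)})_0$; it is a meromorphic $\mathrm{End}(E)$-valued 1-form with at most simple poles at $D$. **$\alpha$-stability.** For a holomorphic subbundle $S\subseteq E$, with induced parabolic structure, put $s_i^{(k)}=\dim(S_{p_i}\cap F_i^{(k)})$ and $\mathrm{pardeg}\,S=\deg S+\sum_{i}\sum_{k=1}^{\ell_i+1}(s_i^{(k)}-s_i^{(k-1)})\alpha_i^{(k)}$, $\mathrm{slope}\,S=\mathrm{pardeg}\,S/\mathrm{rk}\,S$. The parabolic Higgs bundle is $\alpha$-stable if $\mathrm{slope}\,S<\mathrm{slope}\,E$ for every nonzero proper holomorphic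 subbundle $S$ with $\varphi(S)\subseteq S\otimes K_C(D)$. (Here $\mathrm{slope}\,E=0$.) *)

(* Defs.v *)
From HB Require Import structures.
From mathcomp Require Import all_boot all_order all_algebra.
From mathcomp Require Import complex.
From mathcomp Require Import all_classical all_reals all_analysis.

Set Implicit Arguments.
Unset Strict Implicit.
Unset Printing Implicit Defensive.

Import Order.TTheory GRing.Theory Num.Theory.
Import numFieldNormedType.Exports.

Local Open Scope classical_set_scope.
Local Open Scope ring_scope.

(* R[i] packed as a numeric field, so that it carries the topology and the
   normed-module structure every numeric field has over itself. *)
Definition CC (R : realType) : numClosedFieldType := R[i].

Section LinearAlgebra.
Variable K : fieldType.

Definition colspan m n (A : 'M[K]_(m, n)) : {vspace 'cV[K]_m} :=
  limg (linfun (mulmx A : 'cV[K]_n -> 'cV[K]_m)).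

Definition maps_into m n (A : 'M[K]_(m, n))
    (U : {vspace 'cV[K]_n}) (V : {vspace 'cV[K]_m}) : Prop :=
  forall v, v \in U -> A *m v \in V.

Definition traceless_part n (A : 'M[K]_n) : 'M[K]_n :=
  A - (\tr A / n%:R)%:M.

End LinearAlgebra.

(* The star-shaped quiver and its branch-increasing dimension vector.  Legs are
   indexed by 'I_nlegs; the nodes of leg i are the (i, k) with 1 <= k <= len i.
   Following the conventions r_i^(0) = 0 and r_i^(l_i + 1) = r_star, the
   indices k = 0 and k = (len i).+1 are also meaningful; larger ones are not. *)
Record star_quiver := StarQuiver {
  nlegs : nat;
  len : 'I_nlegs -> nat;
  rstar : nat;
  rdim : 'I_nlegs -> nat -> nat;
  nlegs_gt0 : (0 < nlegs)%N;
  len_gt0 : forall i, (0 < len i)%N;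
  rdim0 : forall i, rdim i 0 = 0%N;
  rdim_top : forall i, rdim i (len i).+1 = rstar;
  rdim_lt : forall i k, (k <= len i)%N -> (rdim i k < rdim i k.+1)%N }.

Section Representations.
Variables (R : realType) (Q : star_quiver).
Local Notation C := (CC R).

(* Only the indices 1 <= k <= len i matter: the matrices at k = 0 have an
   empty dimension (so x_i^(0) = 0 and y_i^(0) = 0), and those with k > len i
   are never used. *)
Record doubled_rep := DoubledRep {
  xmap : forall (i : 'I_(nlegs Q)) (k : nat), 'M[C]_(rdim i k.+1, rdim i k);
  ymap : forall (i : 'I_(nlegs Q)) (k : nat), 'M[C]_(rdim i k, rdim i k.+1) }.

Variable A : doubled_rep.

Definition xstar i : 'M[C]_(rstar Q, rdim i (len i)) :=
  castmx (rdim_top i, erefl) (xmap A i (len i)).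

Definition ystar i : 'M[C]_(rdim i (len i), rstar Q) :=
  castmx (erefl, rdim_top i) (ymap A i (len i)).

Definition residue_of i : 'M[C]_(rstar Q) :=
  traceless_part (xstar i *m ystar i).

Definition moment_level (tau : 'I_(nlegs Q) -> nat -> C) : Prop :=
  \sum_i residue_of i = 0 /\
  forall i k, (k < len i)%N ->
    ymap A i k.+1 *m xmap A i k.+1 - xmap A i k *m ymap A i k
    = (tau i k.+1)%:M.

(* For k <= j: x_i^(j-1) o ... o x_i^(k), the matrix pid_mx (rdim i k) being
   the identity when j = k.  The value for j < k is irrelevant. *)
Fixpoint xpath (i : 'I_(nlegs Q)) (k j : nat) : 'M[C]_(rdim i j, rdim i k) :=
  match j with
  | 0 => pid_mx (rdim i k)
  | j'.+1 => if (k <= j')%N then xmap A i j' *m xpath i k j'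
             else pid_mx (rdim i k)
  end.

(* X_i^(k) = x_i^(l_i) o ... o x_i^(k), for 1 <= k <= l_i *)
Definition xcomp i k : 'M[C]_(rstar Q, rdim i k) := xstar i *m xpath i k (len i).

Definition rep_flag i k : {vspace 'cV[C]_(rstar Q)} :=
  if k == 0 then 0%VS
  else if (k <= len i)%N then colspan (xcomp i k)
  else fullv.

Record subspaces := Subspaces {
  sub_star : {vspace 'cV[C]_(rstar Q)};
  sub_node : forall (i : 'I_(nlegs Q)) (k : nat), {vspace 'cV[C]_(rdim i k)} }.

Definition is_subrep (S : subspaces) : Prop :=
  (forall i k, (0 < k < len i)%N ->
     maps_into (xmap A i k) (sub_node S i k) (sub_node S i k.+1) /\
     maps_into (ymap A i k) (sub_node S i k.+1) (sub_node S i k)) /\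
  (forall i,
     maps_into (xstar i) (sub_node S i (len i)) (sub_star S) /\
     maps_into (ystar i) (sub_star S) (sub_node S i (len i))).

Definition subspaces_nonzero (S : subspaces) : Prop :=
  sub_star S <> 0%VS \/
  exists i k, (0 < k <= len i)%N /\ sub_node S i k <> 0%VS.

Definition subspaces_proper (S : subspaces) : Prop :=
  sub_star S <> fullv \/
  exists i k, (0 < k <= len i)%N /\ sub_node S i k <> fullv.

Definition beta_star (beta : 'I_(nlegs Q) -> nat -> R) : R :=
  - ((rstar Q)%:R^-1 *
     \sum_i \sum_(1 <= k < (len i).+1) (rdim i k)%:R * beta i k).

Definition beta_tilde (beta : 'I_(nlegs Q) -> nat -> R) (S : subspaces) : R :=
  (\dim (sub_star S))%:R * beta_star beta +
  \sum_i \sum_(1 <= k < (len i).+1) (\dim (sub_node S i k))%:R * beta i k.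

Definition beta_stable (beta : 'I_(nlegs Q) -> nat -> R) : Prop :=
  forall S, is_subrep S -> subspaces_nonzero S -> subspaces_proper S ->
    beta_tilde beta S < 0.

End Representations.

(* The values w i k, 1 <= k <= (len i).+1, with prescribed consecutive
   differences b and vanishing sum weighted by m_i^(k) = r_i^(k) - r_i^(k-1). *)
Definition determined_weights (Q : star_quiver) (V : zmodType)
    (b w : 'I_(nlegs Q) -> nat -> V) : Prop :=
  forall i : 'I_(nlegs Q),
    (forall k, (0 < k <= len i)%N -> w i k - w i k.+1 = b i k) /\
    \sum_(1 <= k < (len i).+2) w i k *+ (rdim i k - rdim i k.-1)%N = 0.

Section ProjectiveLine.
Variable R : realType.
Local Notation C := (CC R).

(* CP^1; None is the point at infinity. *)
Definition P1 := option C.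

(* Local holomorphic parameter t centred at q (w = 1/z at infinity). *)
Definition local_param (q : P1) (t : C) : P1 :=
  match q with
  | Some z => Some (z + t)
  | None => if t == 0 then None else Some t^-1
  end.

Definition holomorphic_at0 (f : C -> C) : Prop :=
  \forall t \near (0 : C), derivable f t 1.

Definition meromorphic_at0 (f : C -> C) : Prop :=
  exists (h : C -> C) (m : nat), holomorphic_at0 h /\
    \forall t \near 0^', f t = h t / t ^+ m.

(* f is meromorphic at 0, not identically zero there, of order k. *)
Definition order_at0 (f : C -> C) (k : int) : Prop :=
  exists u : C -> C, holomorphic_at0 u /\ u 0 != 0 /\
    \forall t \near 0^', f t = u t * t ^ k.

Section Subbundles.
Variable r : nat.

Definition local_frame s (S : P1 -> {vspace 'cV[C]_r}) (q : P1)
    (N : C -> 'M[C]_(r, s)) : Prop :=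
  (forall i j, holomorphic_at0 (fun t => N t i j)) /\
  \forall t \near (0 : C), colspan (N t) = S (local_param q t).

(* Rank-s holomorphic subbundle of the trivial bundle O^r: a family of
   s-dimensional fibres, locally spanned by s holomorphic sections. *)
Definition holomorphic_subbundle s (S : P1 -> {vspace 'cV[C]_r}) : Prop :=
  (forall q, \dim (S q) = s) /\
  (forall q, exists N : C -> 'M[C]_(r, s), local_frame S q N).

(* The columns of M form a meromorphic frame of S near q, and k is the order
   at q of the meromorphic section M_1 /\ ... /\ M_s of det S: relative to a
   local holomorphic frame N this section is \det g *: N_1 /\ ... /\ N_s. *)
Definition frame_order s (S : P1 -> {vspace 'cV[C]_r})
    (M : P1 -> 'M[C]_(r, s)) (q : P1) (k : int) : Prop :=
  exists (N : C -> 'M[C]_(r, s)) (g : C -> 'M[C]_s),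
    [/\ local_frame S q N,
        forall i j, meromorphic_at0 (fun t => g t i j),
        \forall t \near 0^', M (local_param q t) = N t *m g t
      & order_at0 (fun t => \det (g t)) k].

(* d is the degree of det S, i.e. the degree of the divisor of the nonzero
   meromorphic section of det S given by a global meromorphic frame.  Every
   holomorphic subbundle on CP^1 has such a frame, and d does not depend on
   the frame. *)
Definition has_degree s (S : P1 -> {vspace 'cV[C]_r}) (d : int) : Prop :=
  exists (M : P1 -> 'M[C]_(r, s)) (ord : P1 -> int),
    [/\ forall q, frame_order S M q (ord q),
        finite_set [set q | ord q != 0]
      & d = \sum_(q \in [set: P1]) ord q].

End Subbundles.

(* A parabolic Higgs bundle whose underlying bundle is O^rank on CP^1, with
   parabolic points the Some (hpt i), flags 0 = F_i^(0) <= ... <=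
   F_i^(hlen i + 1), weights hwt i k attached to F_i^(k), and Higgs field
   \sum_i hres i dz / (z - hpt i), where \sum_i hres i = 0 (no pole at
   infinity). *)
Record parabolic_higgs := ParabolicHiggs {
  hrank : nat;
  npts : nat;
  hpt : 'I_npts -> C;
  hlen : 'I_npts -> nat;
  hflag : 'I_npts -> nat -> {vspace 'cV[C]_hrank};
  hwt : 'I_npts -> nat -> R;
  hres : 'I_npts -> 'M[C]_hrank }.

Section Stability.
Variable H : parabolic_higgs.

(* Value at q of the Higgs field, a section of End(E) (x) K(D), relative to a
   nowhere vanishing local section of the line bundle K(D):
   dz / \prod_j (z - hpt j) over the affine line, and dz / z^2 = - d(1/z) near
   infinity, where
     z^2 \sum_i hres i / (z - hpt i) = z \sum_i hres i + \sum_i hpt i hres i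
                                       + O(1/z)
   and \sum_i hres i = 0. *)
Definition higgs_value (q : P1) : 'M[C]_(hrank H) :=
  match q with
  | Some z => \sum_i (\prod_(j | j != i) (z - hpt j)) *: hres i
  | None => \sum_i hpt i *: @hres H i
  end.

(* phi(S) is contained in S (x) K(D), fibrewise. *)
Definition higgs_invariant (S : P1 -> {vspace 'cV[C]_(hrank H)}) : Prop :=
  forall q, maps_into (higgs_value q) (S q) (S q).

Definition flag_dim (S : P1 -> {vspace 'cV[C]_(hrank H)}) i k : nat :=
  \dim (S (Some (hpt i)) :&: @hflag H i k).

(* Parabolic degree of S, given that deg S = d. *)
Definition pardeg (S : P1 -> {vspace 'cV[C]_(hrank H)}) (d : int) : R :=
  d%:~R + \sum_i \sum_(1 <= k < (hlen i).+2)
    ((flag_dim S i k)%:R - (flag_dim S i k.-1)%:R) * @hwt H i k.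

Definition slope (S : P1 -> {vspace 'cV[C]_(hrank H)}) (d : int) (s : nat) : R :=
  pardeg S d / s%:R.

(* The right-hand side is the slope of the bundle itself, the trivial bundle
   O^hrank, whose degree is 0. *)
Definition alpha_stable : Prop :=
  forall (s : nat) (S : P1 -> {vspace 'cV[C]_(hrank H)}) (d : int),
    (0 < s < hrank H)%N ->
    holomorphic_subbundle s S -> higgs_invariant S -> has_degree s S d ->
    slope S d s < slope (fun=> fullv) 0 (hrank H).

End Stability.

End ProjectiveLine.

(* The Higgs bundle T(x, y) with marked points p and weights alpha. *)
Definition higgs_of_rep (R : realType) (Q : star_quiver)
    (p : 'I_(nlegs Q) -> CC R) (alpha : 'I_(nlegs Q) -> nat -> R)
    (A : doubled_rep R Q) : parabolic_higgs R :=
  {| hpt := p;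
     hlen := @len Q;
     hflag := rep_flag A;
     hwt := alpha;
     hres := residue_of A |}.

(* Main.v *)
Require Import Defs.
From HB Require Import structures.
From mathcomp Require Import all_boot all_order all_algebra.
From mathcomp Require Import complex ring lra.
From mathcomp Require Import all_classical all_reals all_analysis.
Set Implicit Arguments.
Unset Strict Implicit.
Unset Printing Implicit Defensive.
Import Order.TTheory GRing.Theory Num.Theory.
Import numFieldNormedType.Exports.
Local Open Scope classical_set_scope.
Local Open Scope ring_scope.

(* A subbundle S of the trivial bundle has degree d <= 0, with equality only if
   S is constant: multiplying the maximal minors of a global meromorphic frame
   by the scalar rational function with divisor minus that of the frame on the
   affine line gives functions that are holomorphic on the affine line and
   vanish to order at least d at infinity.  If d >= 0 they are constant by
   Liouville, not all zero, hence d = 0 and the Pluecker coordinates of the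
   fibres of S are constant.
   If d <= -1, then pardeg S <= -1 + sum r beta + s beta_star < 0.  If d = 0,
   the constant fibre V is invariant under all residues, the preimages of V
   under the maps X_i^(k) form a subrepresentation, and beta-stability makes
   pardeg S negative.  The subrepresentation of the kernels of the X_i^(k)
   (V = 0) is zero by stability, so the flags have the expected dimensions and
   the slope of E is 0.
   Liouville's theorem is proved without integration: Goursat's bisection works
   for midpoint Riemann sums, which are exact on affine functions. *)

(** * Goursat for Riemann sums *)

(** Compactness by nested squares: if [P] fails on a square, it fails on one of its quarters.
    Iterating, the failing squares shrink to a point [(a, b)], where the local hypothesis
    contradicts the failure. It serves both for Goursat's estimate and for functions with zero
    derivative. *)
Lemma square_bisection_ind (R : realType) (P : R -> R -> R -> Prop) :
  (forall x y L, 0 < L -> P x y (L / 2) -> P (x + L / 2) y (L / 2) ->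
     P x (y + L / 2) (L / 2) -> P (x + L / 2) (y + L / 2) (L / 2) -> P x y L) ->
  (forall a b, exists2 delta, 0 < delta & forall x y L, 0 < L < delta ->
     x <= a <= x + L -> y <= b <= y + L -> P x y L) ->
  forall x y L, 0 < L -> P x y L.
Proof.
move=> Psplit Plocal x0 y0 L0 L0_gt0; apply: contrapT => nP0.
(* The hypotheses on [s] are placed under the existential so that [choice] yields a total successor
   function. *)
have step (s : R * R * R) : exists s' : R * R * R,
    0 < s.2 -> ~ P s.1.1 s.1.2 s.2 ->
    [/\ s'.2 = s.2 / 2, s.1.1 <= s'.1.1 <= s.1.1 + s.2 / 2,
        s.1.2 <= s'.1.2 <= s.1.2 + s.2 / 2 & ~ P s'.1.1 s'.1.2 s'.2].
  case: s => [[x y] L] /=.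
  have [[L_gt0 nP]|] := pselect (0 < L /\ ~ P x y L); last first.
    by move=> h; exists (x, y, L) => ? ?; case: h.
  have [P1|nP1] := pselect (P x y (L / 2)); last first.
    by exists (x, y, L / 2) => _ _ /=; split=> //; lra.
  have [P2|nP2] := pselect (P (x + L / 2) y (L / 2)); last first.
    by exists (x + L / 2, y, L / 2) => _ _ /=; split=> //; lra.
  have [P3|nP3] := pselect (P x (y + L / 2) (L / 2)); last first.
    by exists (x, y + L / 2, L / 2) => _ _ /=; split=> //; lra.
  have [P4|nP4] := pselect (P (x + L / 2) (y + L / 2) (L / 2)); last first.
    by exists (x + L / 2, y + L / 2, L / 2) => _ _ /=; split=> //; lra.
  by exfalso; apply/nP/Psplit.
have [nxt nxtP] := choice step.
pose sq n := iter n nxt (x0, y0, L0).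
have sqP n : (sq n).2 = L0 / 2 ^+ n /\ ~ P (sq n).1.1 (sq n).1.2 (sq n).2.
  elim: n => [|n [EL nP]]; first by rewrite expr0 divr1.
  have /nxtP/(_ nP)[EL' _ _ nP'] : 0 < (sq n).2.
    by rewrite EL divr_gt0 // exprn_gt0.
  by split=> //; rewrite [LHS]EL' EL exprSr invfM mulrA.
have L_gt0 n : 0 < (sq n).2 by rewrite (sqP n).1 divr_gt0 // exprn_gt0.
have nested n m : [/\ (sq n).1.1 <= (sq (m + n)%N).1.1,
    (sq n).1.2 <= (sq (m + n)%N).1.2,
    (sq (m + n)%N).1.1 + (sq (m + n)%N).2 <= (sq n).1.1 + (sq n).2 &
    (sq (m + n)%N).1.2 + (sq (m + n)%N).2 <= (sq n).1.2 + (sq n).2].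
  elim: m => [|m [IH1 IH2 IH3 IH4]]; first by split.
  have [EL] := nxtP _ (L_gt0 (m + n)%N) (sqP (m + n)%N).2.
  rewrite addSn /= -/(sq (m + n)%N) EL.
  by have := L_gt0 (m + n)%N => *; split; lra.
(* Used for each coordinate: every upper end bounds all the lower ends, so the supremum of the lower
   ends lies in all the nested intervals. *)
have cross (f : R * R -> R) :
    (forall n m, f (sq n).1 <= f (sq (m + n)%N).1) ->
    (forall n m, f (sq (m + n)%N).1 + (sq (m + n)%N).2 <= f (sq n).1 + (sq n).2) ->
    exists a, forall n, f (sq n).1 <= a <= f (sq n).1 + (sq n).2.
  move=> f_le f_ge.
  have ub n : ubound (range (fun m => f (sq m).1)) (f (sq n).1 + (sq n).2).
    move=> _ [m _ <-].
    have := f_le m n; have := f_ge n m; rewrite addnC.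
    by have := L_gt0 (n + m)%N; lra.
  have ne : range (fun m => f (sq m).1) !=set0 by exists (f (sq 0%N).1), 0%N.
  exists (sup (range (fun m => f (sq m).1))) => n.
  rewrite (ge_sup ne (ub n)) andbT.
  by apply: ub_le_sup; [exists (f (sq 0%N).1 + (sq 0%N).2); apply: ub | exists n].
have [a aP] : exists a, forall n, (sq n).1.1 <= a <= (sq n).1.1 + (sq n).2.
  by apply: (cross fst) => n m; case: (nested n m).
have [b bP] : exists a, forall n, (sq n).1.2 <= a <= (sq n).1.2 + (sq n).2.
  by apply: (cross snd) => n m; case: (nested n m).
have [delta delta_gt0 dP] := Plocal a b.
have [n nP] : exists n : nat, L0 / 2 ^+ n < delta.
  (* Since [n < 2 ^ n], an Archimedean bound for [L0 / delta] is already enough bisections. *)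
  exists (Num.bound (L0 / delta)).
  rewrite ltr_pdivrMr ?exprn_gt0 // mulrC -ltr_pdivrMr //.
  apply: lt_trans (archi_boundP _) _; first by rewrite divr_ge0 // ltW.
  by rewrite -natrX ltr_nat ltn_expl.
apply: (sqP n).2; apply: dP => //.
by rewrite L_gt0 (sqP n).1.
Qed.

(** * Midpoint sums along segments and squares *)

Section MidpointSums.
Variable K : numClosedFieldType.
Implicit Types (f g : K -> K) (c v : K).

(* Midpoint Riemann sums of f along [c, c + v] with 2^n steps. *)
Fixpoint midsum n f c v : K :=
  if n is n'.+1 then midsum n' f c (v / 2) + midsum n' f (c + v / 2) (v / 2)
  else f (c + v / 2) * v.

(** The midpoint rule is exact on affine functions. This replaces the existence of a primitive:
    affine parts cancel around a square at every level [n]. *)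
Lemma midsum_affine n a b c v :
  midsum n (fun z => a + b * z) c v = a * v + b * (c * v + v ^+ 2 / 2).
Proof. by elim: n c v => [|n IHn] c v /=; rewrite ?IHn; field. Qed.

Lemma midsumD n f g c v :
  midsum n (fun z => f z + g z) c v = midsum n f c v + midsum n g c v.
Proof. by elim: n c v => [|n IHn] c v /=; rewrite ?IHn; ring. Qed.

Lemma midsumZ n a f c v : midsum n (fun z => a * f z) c v = a * midsum n f c v.
Proof. by elim: n c v => [|n IHn] c v /=; rewrite ?IHn; ring. Qed.

Lemma midsum_norm n f c v M :
  (forall t, 0 <= t <= 1 -> `|f (c + t * v)| <= M) ->
  `|midsum n f c v| <= M * `|v|.
Proof.
have half_ge0 : (0 : K) <= 2^-1 by rewrite invr_ge0.
have half_le1 : (2^-1 : K) <= 1 by rewrite invf_le1 // ler1n.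
have halves : (2^-1 : K) + 2^-1 = 1 by field.
elim: n c v => [|n IHn] c v fM /=.
  by rewrite normrM ler_wpM2r // [v / 2]mulrC fM // half_ge0.
apply: le_trans (ler_normD _ _) _.
have -> : M * `|v| = M * `|v / 2| + M * `|v / 2|.
  by rewrite normrM (ger0_norm half_ge0); field.
apply: lerD; apply: IHn => t /andP[t0 t1].
  rewrite (_ : t * (v / 2) = (t / 2) * v); last by ring.
  by apply: fM; rewrite mulr_ge0 //= mulr_ile1.
rewrite -addrA (_ : v / 2 + t * (v / 2) = (2^-1 + t * 2^-1) * v); last by ring.
apply: fM; rewrite addr_ge0 ?mulr_ge0 //=.
by rewrite -[leRHS]halves lerD2l ler_piMl.
Qed.

(** The step [v] is kept inside the bound, since [f z * v] is what a side contributes; each half of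
    the segment then inherits the bound [m / 2]. *)
Lemma midsum_Im n f c v m :
  (forall t, 0 <= t <= 1 -> m <= 'Im (f (c + t * v) * v)) ->
  m <= 'Im (midsum n f c v).
Proof.
have half_ge0 : (0 : K) <= 2^-1 by rewrite invr_ge0.
have half_gt0 : (0 : K) < 2^-1 by rewrite invr_gt0.
have half_le1 : (2^-1 : K) <= 1 by rewrite invf_le1 // ler1n.
have halves : (2^-1 : K) + 2^-1 = 1 by field.
have ImH (z : K) : 'Im (z / 2) = 'Im z / 2.
  by rewrite mulrC ImMl ?ger0_real // mulrC.
elim: n c v m => [|n IHn] c v m fM /=.
  by rewrite [v / 2]mulrC; apply: fM; rewrite half_ge0.
rewrite raddfD /= (_ : m = m / 2 + m / 2); last by field.
apply: lerD; apply: IHn => t /andP[t0 t1]; rewrite mulrA ImH ler_pM2r //.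
  rewrite (_ : t * (v / 2) = (t / 2) * v); last by ring.
  by apply: fM; rewrite mulr_ge0 //= mulr_ile1.
rewrite -addrA (_ : v / 2 + t * (v / 2) = (2^-1 + t * 2^-1) * v); last by ring.
apply: fM; rewrite addr_ge0 ?mulr_ge0 //=.
by rewrite -[leRHS]halves lerD2l ler_piMl.
Qed.

(* The midpoint sum along the boundary of the square with lower left corner c
   and side L > 0, counterclockwise. *)
Definition square_sum n f c (L : K) :=
  midsum n f c L + midsum n f (c + L) ('i * L)
  - midsum n f (c + 'i * L) L - midsum n f c ('i * L).

(** Raising the level by one splits each outer side at its midpoint, and the inner sides of the four
    quarters cancel in pairs. *)
Lemma square_sum_split n f c L :
  square_sum n.+1 f c L =
  square_sum n f c (L / 2) + square_sum n f (c + L / 2) (L / 2)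
  + square_sum n f (c + 'i * (L / 2)) (L / 2)
  + square_sum n f (c + L / 2 + 'i * (L / 2)) (L / 2).
Proof.
rewrite /square_sum /= -!mulrA.
rewrite (_ : c + L / 2 + L / 2 = c + L); last by field.
rewrite (_ : c + 'i * (L / 2) + 'i * (L / 2) = c + 'i * L); last by field.
rewrite (_ : c + L / 2 + 'i * (L / 2) + L / 2 = c + L + 'i * (L / 2)); last by field.
rewrite (_ : c + L / 2 + 'i * (L / 2) + 'i * (L / 2) = c + 'i * L + L / 2); last by field.
rewrite (_ : c + 'i * (L / 2) + L / 2 = c + L / 2 + 'i * (L / 2)); last by ring.
by ring.
Qed.

Lemma square_sum_affine n a b c L : square_sum n (fun z => a + b * z) c L = 0.
Proof. by rewrite /square_sum !midsum_affine; ring. Qed.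

Lemma square_sumD n f g c L :
  square_sum n (fun z => f z + g z) c L = square_sum n f c L + square_sum n g c L.
Proof. by rewrite /square_sum !midsumD; ring. Qed.

Lemma square_sumZ n a f c L :
  square_sum n (fun z => a * f z) c L = a * square_sum n f c L.
Proof. by rewrite /square_sum !midsumZ; ring. Qed.

Lemma square_sum_norm n f c L M : 0 < L ->
  (forall t, 0 <= t <= 1 ->
     [/\ `|f (c + t * L)| <= M, `|f (c + L + t * ('i * L))| <= M,
         `|f (c + 'i * L + t * L)| <= M & `|f (c + t * ('i * L))| <= M]) ->
  `|square_sum n f c L| <= M * L *+ 4.
Proof.
move=> L_gt0 fM.
have bnd c' v : `|v| = L -> (forall t, 0 <= t <= 1 -> `|f (c' + t * v)| <= M) ->
    `|midsum n f c' v| <= M * L.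
  by move=> <-; apply: midsum_norm.
have nL : `|L| = L by rewrite gtr0_norm.
have niL : `|'i * L| = L by rewrite normrM normCi mul1r.
rewrite /square_sum !mulrSr mulr0n add0r.
do 3?[apply: le_trans (ler_normD _ _) _; rewrite ?normrN; apply: lerD];
  by apply: bnd => // t /fM[].
Qed.

Lemma Im_le_norm (z : K) : 'Im z <= `|z|.
Proof.
apply: le_trans (real_ler_norm (Creal_Im z)) _.
rewrite -normrN -ReMil; apply: le_trans (leif_normC_Re_Creal _) _.
by rewrite normrM normCi mul1r.
Qed.

(** A crude substitute for the value 2 pi i of the integral of [1 / z] around the origin: each of
    the four sides contributes an imaginary part of at least 1. *)
Lemma square_sum_inv n L : 0 < L ->
  4 <= `|square_sum n GRing.inv (- L - 'i * L) (L *+ 2)|.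
Proof.
move=> L_gt0; have L_neq0 := lt0r_neq0 L_gt0.
have i_neq0 := neq0Ci K.
(* With [s = 2 t - 1] the position on a side, the signed integrand times the step is [2 / (s - 'i)]
   on the bottom and right sides and [- 2 / (s + 'i)] on the top and left ones. Both have imaginary
   part [2 / (s ^+ 2 + 1)]. *)
have key (s : K) : s \is Num.real -> -1 <= s <= 1 ->
    [/\ s - 'i != 0, s + 'i != 0, 1 <= 'Im (2 / (s - 'i)) &
      1 <= 'Im (- 2 / (s + 'i))].
  move=> sR s1.
  have s2_ge0 : 0 <= s ^+ 2 by rewrite real_exprn_even_ge0.
  have s2_le1 : s ^+ 2 <= 1.
    by rewrite -real_normK // exprn_ile1 // real_ler_norml.
  have e : (s - 'i) * (s + 'i) = s ^+ 2 + 1 by rewrite -subr_sqr sqrCi opprK.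
  have d_gt0 : 0 < s ^+ 2 + 1 by rewrite ltr_wpDl.
  have := lt0r_neq0 d_gt0; rewrite -{1}e mulf_eq0 negb_or => /andP[n1 n2].
  have im x : x \is Num.real -> 1 <= 'Im (x / (s ^+ 2 + 1) + 'i * (2 / (s ^+ 2 + 1))).
    move=> xR.
    rewrite Im_rect ?rpred_div ?rpredM ?rpredD ?rpredX ?realn ?real1 //.
    by rewrite ler_pdivlMr // mul1r (_ : 2 = 1 + 1) // lerD2r.
  split=> //.
    rewrite (_ : 2 / _ = 2 * s / (s ^+ 2 + 1) + 'i * (2 / (s ^+ 2 + 1))).
      by apply: im; rewrite rpredM ?realn.
    by rewrite -e; field; rewrite n1 n2.
  rewrite (_ : - 2 / _ = - (2 * s) / (s ^+ 2 + 1) + 'i * (2 / (s ^+ 2 + 1))).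
    by apply: im; rewrite rpredN rpredM ?realn.
  by rewrite -e; field; rewrite n1 n2.
have sP (t : K) : 0 <= t <= 1 -> t *+ 2 - 1 \is Num.real /\ -1 <= t *+ 2 - 1 <= 1.
  move=> /andP[t0 t1].
  rewrite rpredB ?rpredMn ?ger0_real ?ler01 //; split=> //.
  rewrite lerBrDr addNr mulrn_wge0 //= lerBlDr.
  by rewrite (_ : 1 + 1 = 1 *+ 2) // lerMn2r.
apply: le_trans (Im_le_norm _).
have negE c v : - midsum n GRing.inv c v = midsum n (fun z => - 1 * z^-1) c v.
  by rewrite midsumZ mulN1r.
rewrite /square_sum !negE !raddfD /= (_ : 4 = 1 + 1 + 1 + 1); last by ring.
do 3?apply: lerD; apply: midsum_Im => t /sP[];
  set s := t *+ 2 - 1 => sR s1; have [n1 n2 im1 im2] := key _ sR s1.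
- rewrite (_ : _ + _ = L * (s - 'i)); last by rewrite /s; ring.
  by rewrite (_ : _^-1 * _ = 2 / (s - 'i)) //; clearbody s; field; apply/andP.
- rewrite (_ : _ + _ = 'i * L * (s - 'i)); last first.
    by rewrite mulrBr ['i * L * 'i]mulrAC -expr2 sqrCi /s; ring.
  by rewrite (_ : _^-1 * _ = 2 / (s - 'i)) //; clearbody s; field; apply/and3P.
- rewrite (_ : _ + _ = L * (s + 'i)); last by rewrite /s; ring.
  by rewrite (_ : _ * _ = - 2 / (s + 'i)) //; clearbody s; field; apply/andP.
rewrite (_ : _ + _ = 'i * L * (s + 'i)); last first.
  by rewrite ['i * L * (s + 'i)]mulrDr ['i * L * 'i]mulrAC -expr2 sqrCi /s; ring.
by rewrite (_ : _ * _ = - 2 / (s + 'i)) //; clearbody s; field; apply/and3P.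
Qed.
End MidpointSums.

(** * Goursat's estimate for complex differentiable functions *)

Section Goursat.
Variable R : realType.
Local Notation C := (CC R).
Implicit Types (f g : C -> C) (z D : C).

Lemma realC_gt0 (r : R) : (0 < (r%:C%C : C)) = (0 < r).
Proof. by rewrite ltcE /= eqxx. Qed.

Lemma realC_ge0 (r : R) : (0 <= (r%:C%C : C)) = (0 <= r).
Proof. by rewrite lecE /= eqxx. Qed.

(** Balls in [CC R] have radii in [CC R]; a positive radius there is real, so its real part can be
    used. *)
Lemma nbhs0_norm (P : C -> Prop) : (\forall t \near (0 : C), P t) ->
  exists2 delta : R, 0 < delta & forall t : C, `|t| < delta%:C%C -> P t.
Proof.
move=> /(@nbhs_ballP C C (0 : C))[d /= d_gt0 dP].
exists (complex.Re d); first by move: d_gt0; rewrite ltcE => /andP[].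
have -> : (complex.Re d)%:C%C = d by rewrite RRe_real // ger0_real // ltW.
by move=> t td; apply: dP; rewrite -ball_normE /= sub0r normrN.
Qed.

Lemma dnbhs0_norm (P : C -> Prop) : (\forall t \near (0 : C)^', P t) ->
  exists2 delta : R, 0 < delta & forall t : C, `|t| < delta%:C%C -> t != 0 -> P t.
Proof. by rewrite near_withinE; apply: nbhs0_norm. Qed.

Lemma derivable_approx f z : derivable f z 1 ->
  exists D : C, forall e : C, 0 < e -> exists2 delta : R, 0 < delta &
    forall w, `|w - z| < delta%:C%C -> `|f w - f z - D * (w - z)| <= e * `|w - z|.
Proof.
move=> /cvg_ex[D /= fD]; exists (D : C) => e e_gt0.
have := (@cvgrPdist_le C C C (0^') (dnbhs_filter _) _ D).1 fD e e_gt0.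
move=> /dnbhs0_norm[d d_gt0 dP]; exists d => // w wz.
have [->|wz_neq] := eqVneq w z; first by rewrite !subrr mulr0 subr0 normr0 mulr0.
have h_neq0 : w - z != 0 by rewrite subr_eq0.
have scaleE (a b : C) : (a *: (b : C)) = a * b by [].
have := dP (w - z) wz h_neq0; rewrite !scaleE mulr1 subrK => le_e.
have -> : f w - f z - D * (w - z) = ((w - z)^-1 * (f w - f z) - D) * (w - z).
  by rewrite mulrBl mulrAC mulVf // mul1r.
rewrite normrM; apply: ler_pM => //.
by rewrite distrC.
Qed.

Lemma rect_norm (u v L : C) : `|u| <= L -> `|v| <= L -> `|u + 'i * v| <= L *+ 2.
Proof.
move=> uL vL; apply: le_trans (ler_normD _ _) _.
by rewrite mulr2n normrM normCi mul1r lerD.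
Qed.

(** The bound [eps * L ^+ 2] is additive over the four quarters, so bisection reduces it to small
    squares around a point, where [f] is affine up to a small error. No limit of the sums is taken:
    the bound holds at all high enough levels. *)
Lemma goursat f (eps : C) (x y L : R) :
  (forall z, derivable f z 1) -> 0 < eps -> 0 < L ->
  exists n0, forall n, (n0 <= n)%N ->
    `|square_sum n f (x +i* y)%C L%:C%C| <= eps * L%:C%C ^+ 2.
Proof.
move=> df eps_gt0; move: x y L; apply: square_bisection_ind.
  move=> x y L L_gt0 [n1 P1] [n2 P2] [n3 P3] [n4 P4].
  (* The successor pays for the split: level [n.+1] on the square is level [n] on its quarters. *)
  exists (maxn n1 (maxn n2 (maxn n3 n4))).+1 => -[//|n].
  rewrite ltnS !geq_max => /and4P[/P1 {}P1 /P2 {}P2 /P3 {}P3 /P4 {}P4].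
  have EL : (L / 2)%:C%C = L%:C%C / 2 :> C by rewrite rmorphM fmorphV rmorphMn rmorph1.
  have Ex : ((x + L / 2) +i* y)%C = (x +i* y)%C + L%:C%C / 2 :> C.
    by rewrite -EL; apply/eqP; rewrite eq_complex /= addr0 !eqxx.
  have Ey (x' : R) : (x' +i* (y + L / 2))%C = (x' +i* y)%C + 'i * (L%:C%C / 2) :> C.
    by rewrite -EL -complexiE; apply/eqP; rewrite eq_complex /= !(mul0r, mul1r, subr0, addr0, add0r) !eqxx.
  move: P1 P2 P3 P4; rewrite !Ey !Ex !EL => P1 P2 P3 P4.
  rewrite square_sum_split.
  have -> : eps * L%:C%C ^+ 2 = eps * (L%:C%C / 2) ^+ 2 + eps * (L%:C%C / 2) ^+ 2
     + eps * (L%:C%C / 2) ^+ 2 + eps * (L%:C%C / 2) ^+ 2 by field.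
  by do 3?[apply: le_trans (ler_normD _ _) _; apply: lerD].
move=> a b.
(* Boundary points lie within [2 L] of the base point, so the error is at most [eps / 8 * 2 L] on
   four sides of length [L], in total [eps * L ^+ 2]. The same distance explains the radius [d / 2]
   below. *)
have [D /(_ (eps / 8))[|d d_gt0 dP]] := derivable_approx (df (a +i* b)%C).
  by rewrite divr_gt0.
exists (d / 2); first by rewrite divr_gt0.
move=> x y L /andP[L_gt0 Ld] ax by_; exists 0%N => n _.
set z0 := (a +i* b)%C : C; set c := (x +i* y)%C : C.
set L' := L%:C%C : C.
have L'_gt0 : 0 < L' by rewrite realC_gt0.
have z0E : z0 = c + ((a - x)%:C%C + 'i * (b - y)%:C%C).
  by rewrite -complexiE; apply/eqP; rewrite eq_complex /= !(mul0r, mul1r, subr0, addr0, add0r) !subrKC !eqxx.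
have near_z0 (s t : C) : 0 <= s <= L' -> 0 <= t <= L' ->
    `|c + (s + 'i * t) - z0| <= L' *+ 2.
  move=> sL tL.
  have aux (r : R) (q : C) : 0 <= r <= L -> 0 <= q <= L' -> `|q - r%:C%C| <= L'.
    move=> /andP[r0 rL] /andP[q0 qL].
    have [r0' rL'] : 0 <= (r%:C%C : C) /\ (r%:C%C : C) <= L'.
      by rewrite realC_ge0 /L' lecR.
    rewrite real_ler_norml ?rpredB ?ger0_real // lerBrDr lerBlDr.
    rewrite (le_trans qL) ?lerDl // andbT.
    by apply: le_trans q0; rewrite addrC subr_le0.
  rewrite z0E (_ : _ - _ = (s - (a - x)%:C%C) + 'i * (t - (b - y)%:C%C)); last by ring.
  by apply: rect_norm; apply: aux => //; lra.
pose e w := f w - f z0 - D * (w - z0).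
have -> : f = (fun w => (f z0 - D * z0 + D * w) + e w).
  by apply/funext => w; rewrite /e; ring.
rewrite square_sumD square_sum_affine add0r.
have -> : eps * L' ^+ 2 = (eps / 8 * (L' *+ 2)) * L' *+ 4 by field.
apply: square_sum_norm => // t /andP[t0 t1].
have e_le s q : 0 <= s <= L' -> 0 <= q <= L' ->
    `|e (c + (s + 'i * q))| <= eps / 8 * (L' *+ 2).
  move=> sL qL; have := near_z0 _ _ sL qL => le2.
  apply: le_trans (dP _ _) _; last by rewrite ler_wpM2l // divr_ge0 // ltW.
  apply: le_lt_trans le2 _.
  by rewrite /L' -rmorphMn /= ltcR; lra.
have r0 : (0 : C) <= 0 <= L' by apply/andP; split=> //; apply: ltW.
have rL : 0 <= L' <= L' by apply/andP; split=> //; apply: ltW.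
have rt : 0 <= t * L' <= L' by rewrite mulr_ge0 ?(ltW L'_gt0) //= ler_piMl // ltW.
split.
- by rewrite -[t * L']addr0 -(mulr0 'i); apply: e_le.
- by rewrite -addrA mulrCA; apply: e_le.
- by rewrite -addrA ['i * L' + _]addrC; apply: e_le.
by rewrite -[t * _]add0r mulrCA; apply: e_le.
Qed.
End Goursat.

(** * Liouville's theorem on the projective line *)

Section Liouville.
Variable R : realType.
Local Notation C := (CC R).
Implicit Types (f g : C -> C) (z D : C).

Lemma ler_norm_rect (u v : C) : u \is Num.real -> v \is Num.real ->
  `|u| <= `|u + 'i * v| /\ `|v| <= `|u + 'i * v|.
Proof.
move=> uR vR; split.
  by rewrite -{1}(Re_rect uR vR); apply: leif_normC_Re_Creal.
rewrite -{1}(Im_rect uR vR) -normrN -ReMil.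
by apply: le_trans (leif_normC_Re_Creal _) _; rewrite normrM normCi mul1r.
Qed.

(* Integrate along large squares: only the term D / z contributes. *)
Lemma entire_coef_inv0 g (g0 D : C) : (forall z, derivable g z 1) ->
  (forall e : C, 0 < e -> exists K : R, forall z, K%:C%C <= `|z| ->
     `|g z - g0 - D / z| * `|z| <= e) ->
  D = 0.
Proof.
move=> dg gE; apply/eqP/negPn/negP => D_neq0.
have nD_gt0 : 0 < `|D| by rewrite normr_gt0.
(* The square has side [2 L] and perimeter [8 L], so the remainder contributes at most 8/9 of the
   norm of [D], and Goursat's bound is set to the last 1/9. The term [D / z] contributes at least 4
   times that norm, a contradiction. *)
have /gE[K KP] : 0 < `|D| / 9 by rewrite divr_gt0.
pose L := Num.max 1 K.
have L_ge1 : 1 <= L by rewrite le_max lexx.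
have L_geK : K <= L by rewrite le_max lexx orbT.
pose L' : C := L%:C%C.
have L_gt0 : 0 < L by apply: lt_le_trans L_ge1.
have L'_gt0 : 0 < L' by rewrite realC_gt0.
have L'_neq0 := lt0r_neq0 L'_gt0.
have L'R : L' \is Num.real by rewrite gtr0_real.
have side_gt0 : 0 < L' *+ 2 by rewrite pmulrn_lgt0.
pose c : C := - L' - 'i * L'.
have eps_gt0 : 0 < `|D| / 9 / (L' *+ 2) ^+ 2 by rewrite !divr_gt0 ?exprn_gt0.
have [n0 /(_ n0 (leqnn _))] := goursat (- L) (- L) dg eps_gt0 (mulrn_wgt0 2 L_gt0).
have -> : (- L +i* - L)%C = c.
  by rewrite /c -complexiE; apply/eqP; rewrite eq_complex /= !(mul0r, mul1r, subr0, oppr0, addr0, add0r) !eqxx.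
rewrite rmorphMn /= -/L' divfK ?expf_neq0 ?lt0r_neq0 // => Gle.
pose e z := g z - g0 - D / z.
have gEq : g = (fun z => (g0 + 0 * z) + (D * z^-1 + e z)).
  by apply/funext => z; rewrite /e; ring.
rewrite {1}gEq square_sumD square_sum_affine add0r square_sumD square_sumZ in Gle.
have e_le (u v : C) : u \is Num.real -> v \is Num.real ->
   L' <= `|u| \/ L' <= `|v| -> `|e (u + 'i * v)| <= `|D| / 9 / L'.
  move=> uR vR h.
  have Lz : L' <= `|u + 'i * v|.
    have [h1 h2] := ler_norm_rect uR vR.
    by case: h => h; [apply: le_trans h h1 | apply: le_trans h h2].
  rewrite ler_pdivlMr //; apply: le_trans (KP (u + 'i * v) _).
    by rewrite ler_wpM2l.
  by apply: le_trans Lz; rewrite lecR.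
have Ele : `|square_sum n0 e c (L' *+ 2)| <= `|D| / 9 *+ 8.
  have -> : `|D| / 9 *+ 8 = (`|D| / 9 / L') * (L' *+ 2) *+ 4 by field.
  apply: square_sum_norm => // t /andP[t0 _].
  have tR : t \is Num.real by rewrite ger0_real.
  have sR : t * (L' *+ 2) - L' \is Num.real by rewrite rpredB ?rpredM ?rpredMn.
  have nL : L' <= `|L'| by rewrite gtr0_norm.
  have nNL : L' <= `|- L'| by rewrite normrN.
  split; rewrite /c.
  - rewrite (_ : _ + _ = (t * (L' *+ 2) - L') + 'i * (- L')); last by ring.
    by apply: e_le => //; [rewrite rpredN | right].
  - rewrite (_ : _ + _ = L' + 'i * (t * (L' *+ 2) - L')); last by ring.
    by apply: e_le => //; left.
  - rewrite (_ : _ + _ = (t * (L' *+ 2) - L') + 'i * L'); last by ring.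
    by apply: e_le => //; right.
  rewrite (_ : - L' - _ + _ = - L' + 'i * (t * (L' *+ 2) - L')); last by ring.
  by apply: e_le => //; [rewrite rpredN | left].
have Dle : `|D| * 4 <= `|D|.
  have Sge := ler_wpM2l (normr_ge0 D) (square_sum_inv n0 L'_gt0).
  apply: le_trans Sge _; rewrite -normrM -/c.
  set a := D * _ in Gle *; set b := square_sum _ e _ _ in Gle Ele.
  have -> : `|D| = `|D| / 9 + `|D| / 9 *+ 8 by field.
  rewrite (_ : a = (a + b) - b); last by ring.
  by apply: le_trans (ler_normB _ _) _; apply: lerD.
move: Dle; rewrite -[leRHS]mulr1 ler_pM2l // lern1 //.
Qed.

(** A zero derivative forces constancy. Bisection of the increments along the bottom and left edges
    of a square takes the place of the mean value theorem. *)
Lemma flat_const f :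
  (forall z (e : C), 0 < e -> exists2 delta : R, 0 < delta &
     forall w, `|w - z| < delta%:C%C -> `|f w - f z| <= e * `|w - z|) ->
  forall z w, f z = f w.
Proof.
move=> f_flat.
have key (e : C) : 0 < e -> forall x y L : R, 0 < L ->
    `|f ((x + L) +i* y)%C - f (x +i* y)%C| <= e * L%:C%C /\
    `|f (x +i* (y + L))%C - f (x +i* y)%C| <= e * L%:C%C.
  move=> e_gt0; apply: square_bisection_ind => [x y L L_gt0|a b].
    have -> : e * L%:C%C = e * (L / 2)%:C%C + e * (L / 2)%:C%C.
      by rewrite -mulrDr -rmorphD /=; congr (_ * (_)%:C%C); field.
    have E (u : R) : u + L / 2 + L / 2 = u + L by field.
    rewrite !E => -[h1 v1] [h2 _] [_ v3] _; split.
      rewrite (_ : _ - _ = f ((x + L) +i* y)%C - f ((x + L / 2) +i* y)%C +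
         (f ((x + L / 2) +i* y)%C - f (x +i* y)%C)); last by ring.
      by apply: le_trans (ler_normD _ _) _; apply: lerD.
    rewrite (_ : _ - _ = f (x +i* (y + L))%C - f (x +i* (y + L / 2))%C +
         (f (x +i* (y + L / 2))%C - f (x +i* y)%C)); last by ring.
    by apply: le_trans (ler_normD _ _) _; apply: lerD.
  (* Both ends of an edge lie within [2 L] of the base point, so each costs [e / 4 * 2 L], and
     together they cost [e * L]. *)
  have e4_gt0 : 0 < e / 4 by rewrite divr_gt0.
  have [d d_gt0 dP] := f_flat (a +i* b)%C _ e4_gt0.
  exists (d / 2); first by rewrite divr_gt0.
  move=> x y L /andP[L_gt0 Ld] ax by_.
  have near_ab (x' y' : R) : `|x' - a| <= L -> `|y' - b| <= L ->
      `|f (x' +i* y')%C - f (a +i* b)%C| <= e / 2 * L%:C%C.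
    move=> xa yb.
    have le2 : `|((x' +i* y')%C : C) - (a +i* b)%C| <= (L%:C%C : C) *+ 2.
      have -> : ((x' +i* y')%C : C) - (a +i* b)%C = (x' - a)%:C%C + 'i * (y' - b)%:C%C.
        by rewrite -complexiE; apply/eqP; rewrite eq_complex /= !(mul0r, mul1r, subr0, addr0, add0r) !eqxx.
      by apply: rect_norm; rewrite normc_def /= expr0n /= addr0 sqrtr_sqr lecR.
    apply: le_trans (dP _ _) _.
      by apply: le_lt_trans le2 _; rewrite -rmorphMn /= ltcR; lra.
    rewrite (_ : e / 2 * _ = e / 4 * ((L%:C%C : C) *+ 2)); last by field.
    by rewrite ler_wpM2l // ltW.
  have tri u v : `|f u - f (a +i* b)%C| <= e / 2 * L%:C%C ->
     `|f v - f (a +i* b)%C| <= e / 2 * L%:C%C -> `|f u - f v| <= e * L%:C%C.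
    move=> hu hv; rewrite (_ : f u - f v = (f u - f (a +i* b)%C) - (f v - f (a +i* b)%C)); last by ring.
    rewrite (_ : e * _ = e / 2 * L%:C%C + e / 2 * L%:C%C); last by field.
    by apply: le_trans (ler_normB _ _) _; apply: lerD.
  by split; apply: tri; apply: near_ab; rewrite ler_norml; lra.
have zero (u : C) (L : R) : 0 < L -> (forall e : C, 0 < e -> `|u| <= e * L%:C%C) -> u = 0.
  move=> L_gt0 h; apply/eqP/negPn/negP => u_neq0.
  have L'_gt0 : 0 < (L%:C%C : C) by rewrite realC_gt0.
  have u_gt0 : 0 < `|u| by rewrite normr_gt0.
  have := h (`|u| / 2 / L%:C%C); rewrite !divr_gt0 // => /(_ isT).
  by rewrite divfK ?lt0r_neq0 // ler_pdivlMr // -[leRHS]mulr1 ler_pM2l // lern1.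
have fx (x y L : R) : 0 < L -> f ((x + L) +i* y)%C = f (x +i* y)%C.
  by move=> L_gt0; apply/eqP; rewrite -subr_eq0; apply/eqP/(zero _ L L_gt0) => e /key-/(_ x y L L_gt0)[].
have fy (x y L : R) : 0 < L -> f (x +i* (y + L))%C = f (x +i* y)%C.
  by move=> L_gt0; apply/eqP; rewrite -subr_eq0; apply/eqP/(zero _ L L_gt0) => e /key-/(_ x y L L_gt0)[].
have fx' (x x' y : R) : f (x +i* y)%C = f (x' +i* y)%C.
  have [xx'|xx'|->//] := ltgtP x x'.
    by rewrite -(fx x y (x' - x)) ?subr_gt0 // subrKC.
  by rewrite -(fx x' y (x - x')) ?subr_gt0 // subrKC.
have fy' (x y y' : R) : f (x +i* y)%C = f (x +i* y')%C.
  have [xx'|xx'|->//] := ltgtP y y'.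
    by rewrite -(fy x y (y' - y)) ?subr_gt0 // subrKC.
  by rewrite -(fy x y' (y - y')) ?subr_gt0 // subrKC.
by move=> [x y] [x' y']; rewrite (fx' x x') (fy' x' y y').
Qed.
End Liouville.

(** * Complex differentiability of scalar functions *)

Section ScalarCalculus.
Variable K : numFieldType.
Implicit Types (f g : K -> K) (z : K).

Lemma scalar_derivable_comp f g z :
  derivable g z 1 -> derivable f (g z) 1 -> derivable (f \o g) z 1.
Proof.
move=> /derivable1_diffP dg /derivable1_diffP df; apply/derivable1_diffP.
exact: differentiable_comp.
Qed.

Lemma scalar_derivable_continuous f z : derivable f z 1 -> {for z, continuous f}.
Proof. by move=> /derivable1_diffP/differentiable_continuous. Qed.

Lemma scalar_derivable_inv z : z != 0 -> derivable (GRing.inv : K -> K) z 1.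
Proof. by move=> z_neq0; apply: (@derivableV K K id z 1 z_neq0); exact: derivable_id. Qed.

Lemma scalar_derivableD f g z : derivable f z 1 -> derivable g z 1 ->
  derivable (fun t => f t + g t) z 1.
Proof. exact: derivableD. Qed.

Lemma scalar_derivableM f g z : derivable f z 1 -> derivable g z 1 ->
  derivable (fun t => f t * g t) z 1.
Proof. exact: derivableM. Qed.

Lemma scalar_derivable_cst (c : K) z : derivable (fun=> c) z 1.
Proof. exact: derivable_cst. Qed.

Lemma scalar_derivable_id z : derivable (fun t : K => t) z 1.
Proof. exact: derivable_id. Qed.

Lemma scalar_derivable_affine (a b z : K) : derivable (fun t => a + b * t) z 1.
Proof.
apply: scalar_derivableD; first exact: scalar_derivable_cst.
by apply: scalar_derivableM; [exact: scalar_derivable_cst | exact: scalar_derivable_id].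
Qed.

Lemma scalar_derivable_eq f g z : (\forall t \near z, f t = g t) ->
  derivable g z 1 -> derivable f z 1.
Proof.
by move=> fg; apply: near_eq_derivable; apply: filterS fg => t ->.
Qed.

Lemma near_neq0 f z : derivable f z 1 -> f z != 0 ->
  \forall t \near z, f t != 0.
Proof. by move=> /scalar_derivable_continuous cf; apply: cvgr_neq0 cf. Qed.
End ScalarCalculus.

Section ProjectiveLiouville.
Variable R : realType.
Local Notation C := (CC R).
Implicit Types (f g : C -> C) (z D : C).

(* Composing F with z |-> a + 1 / z turns the derivative at a into the
   coefficient of 1 / z at infinity, which vanishes for entire functions. *)
Lemma P1_holomorphic_const (F : P1 R -> C) :
  (forall q, derivable (fun t => F (local_param q t)) 0 1) ->
  forall q q', F q = F q'.
Proof.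
move=> dF; pose f z := F (Some z).
have df z : derivable f z 1.
  rewrite (_ : f = (fun t => F (local_param (Some z) t)) \o (fun w => - z + 1 * w)).
    apply: scalar_derivable_comp; last by rewrite mul1r addNr; apply: dF.
    exact: scalar_derivable_affine.
  by apply/funext => w; rewrite /f /= mul1r addNKr.
have finite_const : forall z w, f z = f w.
  apply: flat_const => a.
  have [D Dlim] := derivable_approx (df a).
  suff D0 : D = 0.
    move=> e /Dlim[d d_gt0 dP]; exists d => // w /dP.
    by rewrite D0 mul0r subr0.
  (* For large [z] the expansion of [f] at [a] reads [g z = f a + D / z + o(1 / z)], while the value
     [F None] at 0 makes [g] entire. *)
  pose g z := if z == 0 then F None else f (a + z^-1).
  apply: (@entire_coef_inv0 R g (f a)).
    move=> z; have [->|z_neq0] := eqVneq z 0; last first.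
      apply: (scalar_derivable_eq (g := fun t => f (a + t^-1))).
        have : \forall t \near z, t != 0 by apply: (near_neq0 (f := fun t => t)) => //; exact: scalar_derivable_id.
        by apply: filterS => t t_neq0; rewrite /g (negPf t_neq0).
      apply: (scalar_derivable_comp (f := f) (g := fun t => a + t^-1)) => //.
      apply: (scalar_derivableD (f := fun=> a)); first exact: scalar_derivable_cst.
      exact: scalar_derivable_inv.
    (* The point [a + 1 / z] has parameter [m z] at infinity, so near 0 [g] is [F] in that chart
       composed with [m]. *)
    pose m z := z * (1 + a * z)^-1.
    have dlin : derivable (fun t : C => 1 + a * t) 0 1.
      exact: scalar_derivable_affine.
    have lin0 : 1 + a * 0 != 0 :> C by rewrite mulr0 addr0 oner_neq0.
    apply: (scalar_derivable_eq (g := (fun t => F (local_param None t)) \o m)).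
      have : \forall t \near (0 : C), 1 + a * t != 0.
        exact: near_neq0 dlin lin0.
      apply: filterS => t t_neq0; rewrite /g /m /=.
      have [->|t0] := eqVneq t 0; first by rewrite mul0r eqxx.
      rewrite mulf_eq0 invr_eq0 (negPf t0) (negPf t_neq0) /= invfM invrK.
      by congr (F (Some _)); field.
    apply: scalar_derivable_comp; last by rewrite /m mul0r; apply: dF.
    apply: scalar_derivableM; first exact: scalar_derivable_id.
    by apply: (scalar_derivable_comp (f := GRing.inv) dlin); apply: scalar_derivable_inv.
  move=> e e_gt0; have [d d_gt0 dP] := Dlim e e_gt0.
  exists (2 / d) => z Kz.
  have z_gt0 : 0 < `|z|.
    by apply: lt_le_trans Kz; rewrite realC_gt0 divr_gt0.
  have z_neq0 : z != 0 by rewrite -normr_gt0.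
  have := dP (a + z^-1); rewrite addrC addKr normfV.
  have zd : `|z|^-1 < d%:C%C.
    rewrite -div1r ltr_pdivrMr // -ltr_pdivrMl ?realC_gt0 // mulr1.
    apply: lt_le_trans Kz; rewrite -fmorphV ltcR -[ltLHS]mul1r.
    by rewrite ltr_pM2r ?invr_gt0 // ltr1n.
  move=> /(_ zd) le_e.
  rewrite /g (negPf z_neq0) -ler_pdivlMr //.
have cF := scalar_derivable_continuous (dF None).
(* Constancy on the affine line passes to infinity by continuity, since finite points accumulate
   there. *)
have F_inf : F None = f 0.
  apply/eqP/negPn/negP; rewrite eq_sym -subr_eq0 => d_neq0.
  have : \forall t \near (0 : C), F (local_param None t) != f 0.
    have /cvgrPdist_lt : F (local_param None t) @[t --> (0 : C)] --> F None.
      by have <- : F (local_param None 0) = F None by rewrite /= eqxx.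
    move=> /(_ `|f 0 - F None|); rewrite normr_gt0 => /(_ d_neq0).
    by apply: filterS => t; apply: contraTneq => ->; rewrite distrC ltxx.
  move=> /nbhs0_norm[d d_gt0 dP].
  have /dP : `|(d / 2)%:C%C : C| < d%:C%C.
    by rewrite gtr0_norm ?realC_gt0 ?divr_gt0 // ltcR; lra.
  rewrite /= ifF; last by apply/negbTE/lt0r_neq0; rewrite realC_gt0 divr_gt0.
  by move=> /eqP; apply; apply: finite_const.
by move=> [z|] [z'|] //; rewrite ?F_inf; apply: finite_const.
Qed.
End ProjectiveLiouville.

(** * Degree of a subbundle of the trivial bundle *)

Section Minors.
Variable K : fieldType.

(** Laplace expansion along the replaced row [b]. When the minor on the rows [f] is nonzero, it
    recovers the column span of [N] from maximal minors alone. *)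
Lemma mulmx_adj_rowsub r s (N : 'M[K]_(r, s)) (f : 'I_s -> 'I_r) a b :
  (N *m \adj (rowsub f N)) a b =
  \det (rowsub (fun k => if k == b then a else f k) N).
Proof.
rewrite (expand_det_row _ b) mxE; apply: eq_bigr => j _.
rewrite !mxE eqxx; congr (_ * (_ * \det _)).
by apply/matrixP => i k; rewrite !mxE eq_sym (negPf (neq_lift _ _)).
Qed.

Lemma colspanP m n (A : 'M[K]_(m, n)) v :
  reflect (exists u, v = A *m u) (v \in colspan A).
Proof.
apply: (iffP memv_imgP) => [[u _ ->]|[u ->]]; exists u; rewrite ?lfunE //.
exact: memvf.
Qed.

Lemma colspan_mulmx_unit m n (A : 'M[K]_(m, n)) (U : 'M[K]_n) :
  U \in unitmx -> colspan (A *m U) = colspan A.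
Proof.
move=> Uu; apply/vspaceP => v; apply/colspanP/colspanP => -[u ->].
  by exists (U *m u); rewrite mulmxA.
by exists (invmx U *m u); rewrite -mulmxA mulKVmx.
Qed.

Lemma colspan_scale m n (A : 'M[K]_(m, n)) a :
  a != 0 -> colspan (a *: A) = colspan A.
Proof.
move=> a_neq0; apply/vspaceP => v; apply/colspanP/colspanP => -[u ->].
  by exists (a *: u); rewrite -scalemxAl scalemxAr.
by exists (a^-1 *: u); rewrite -scalemxAl -scalemxAr scalerA mulfV // scale1r.
Qed.

Lemma dim_colspan_le m n (B : 'M[K]_(m, n)) : (\dim (colspan B) <= n)%N.
Proof.
rewrite /colspan; set f := linfun _.
have := limg_ker_dim f fullv; rewrite dimvf /dim /= muln1 => /eq_leq.
exact/leq_trans/leq_addl.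
Qed.

Lemma dim_colspan_row_full m n (A : 'M[K]_(m, n)) :
  \dim (colspan A) = n -> row_full A.
Proof.
move=> dimA; set f := linfun (mulmx A : 'cV_n -> 'cV_m).
have /eqP : \dim (lker f) = 0%N.
  have := limg_ker_dim f fullv; rewrite capfv -/(colspan A) dimA dimvf /dim /= muln1.
  by move/eqP; rewrite -[X in _ == X]add0n eqn_add2r => /eqP.
rewrite dimv_eq0 => /eqP ker0.
rewrite /row_full -mxrank_tr -/(row_free _) -kermx_eq0; apply/eqP/row_matrixP => i.
rewrite row0; set u := row i _.
have : u *m A^T = 0 by apply/sub_kermxP/row_sub.
move/(congr1 trmx); rewrite trmx_mul trmxK trmx0 => Au0.
have : u^T \in lker f by rewrite memv_ker lfunE /= Au0.
by rewrite ker0 memv0 => /eqP/(congr1 trmx); rewrite trmxK trmx0.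
Qed.
End Minors.

Lemma near_and (K : numFieldType) (a : K) (P Q S : K -> Prop) :
  (forall t, P t -> Q t -> S t) ->
  (\forall t \near a, P t) -> (\forall t \near a, Q t) ->
  \forall t \near a, S t.
Proof. by move=> PQS; apply: filterS2. Qed.

Lemma near_all (K : numFieldType) (a : K) (P : K -> Prop) :
  (forall t, P t) -> \forall t \near a, P t.
Proof. exact: filterE. Qed.

Lemma near_norm_lt (K : numFieldType) (f : K -> K) (z u : K) :
  derivable f z 1 -> `|f z| < u -> \forall t \near z, `|f t| < u.
Proof. by move=> /scalar_derivable_continuous cf; apply: cvgr_norm_lt cf _. Qed.

(** * Holomorphic germs at 0 and gluing on CP^1 *)

Section Holomorphic.
Variable R : realType.
Local Notation C := (CC R).
Implicit Types (f g : C -> C).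

Lemma holomorphic_at0_derivable f : holomorphic_at0 f -> derivable f 0 1.
Proof. by move=> hf; apply: (nbhs_singleton (p := (0 : C)) hf). Qed.

Lemma holomorphic_at0_cst (c : C) : holomorphic_at0 (fun=> c).
Proof. by apply: near_all => t; exact: scalar_derivable_cst. Qed.

Lemma holomorphic_at0_id : holomorphic_at0 (fun t : C => t).
Proof. by apply: near_all => t; exact: scalar_derivable_id. Qed.

Lemma holomorphic_at0_affine (a b : C) : holomorphic_at0 (fun t => a + b * t).
Proof. by apply: near_all => t; exact: scalar_derivable_affine. Qed.

Lemma holomorphic_at0D f g : holomorphic_at0 f -> holomorphic_at0 g ->
  holomorphic_at0 (fun t => f t + g t).
Proof. by apply: near_and => t; exact: scalar_derivableD. Qed.

Lemma holomorphic_at0M f g : holomorphic_at0 f -> holomorphic_at0 g ->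
  holomorphic_at0 (fun t => f t * g t).
Proof. by apply: near_and => t; exact: scalar_derivableM. Qed.

Lemma holomorphic_at0_sum I (r : seq I) (P : pred I) (F : I -> C -> C) :
  (forall i, P i -> holomorphic_at0 (F i)) ->
  holomorphic_at0 (fun t => \sum_(i <- r | P i) F i t).
Proof.
move=> FP; elim: r => [|i r IHr].
  by under eq_fun do rewrite big_nil; exact: holomorphic_at0_cst.
have [Pi|nPi] := boolP (P i); last first.
  by under eq_fun do rewrite big_cons (negPf nPi).
under eq_fun do rewrite big_cons Pi.
exact: holomorphic_at0D (FP i Pi) IHr.
Qed.

Lemma holomorphic_at0_prod I (r : seq I) (P : pred I) (F : I -> C -> C) :
  (forall i, P i -> holomorphic_at0 (F i)) ->
  holomorphic_at0 (fun t => \prod_(i <- r | P i) F i t).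
Proof.
move=> FP; elim: r => [|i r IHr].
  by under eq_fun do rewrite big_nil; exact: holomorphic_at0_cst.
have [Pi|nPi] := boolP (P i); last first.
  by under eq_fun do rewrite big_cons (negPf nPi).
under eq_fun do rewrite big_cons Pi.
exact: holomorphic_at0M (FP i Pi) IHr.
Qed.

Lemma holomorphic_at0_det n (N : C -> 'M[C]_n) :
  (forall i j, holomorphic_at0 (fun t => N t i j)) ->
  holomorphic_at0 (fun t => \det (N t)).
Proof.
move=> NP; rewrite /determinant; apply: holomorphic_at0_sum => s _; apply: holomorphic_at0M.
  exact: holomorphic_at0_cst.
by apply: holomorphic_at0_prod.
Qed.

Lemma holomorphic_at0_neq0 f : holomorphic_at0 f -> f 0 != 0 ->
  \forall t \near (0 : C), f t != 0.
Proof. by move=> /holomorphic_at0_derivable; exact: near_neq0. Qed.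

Lemma holomorphic_at0X f n : holomorphic_at0 f -> holomorphic_at0 (fun t => f t ^+ n).
Proof.
move=> hf; elim: n => [|n IHn].
  by under eq_fun do rewrite expr0; exact: holomorphic_at0_cst.
have -> : (fun t => f t ^+ n.+1) = (fun t => f t * f t ^+ n).
  by apply/funext => t; rewrite exprS.
exact: holomorphic_at0M hf IHn.
Qed.

Lemma holomorphic_at0_exprz f (k : int) : holomorphic_at0 f -> f 0 != 0 ->
  holomorphic_at0 (fun t => f t ^ k).
Proof.
move=> hf f0.
case: k => n; first exact: holomorphic_at0X.
have := holomorphic_at0X n.+1 hf; have := holomorphic_at0_neq0 hf f0; apply: near_and => t ft0 dfX.
by apply: (scalar_derivable_comp (f := GRing.inv) dfX); apply: scalar_derivable_inv; rewrite expf_neq0.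
Qed.

(** If the values at 0 differed, the difference would stay nonzero nearby by continuity; a small
    positive real point refutes this. *)
Lemma punctured_eq f g : derivable f 0 1 -> derivable g 0 1 ->
  (\forall t \near (0 : C)^', f t = g t) -> f 0 = g 0.
Proof.
move=> df dg /dnbhs0_norm[d d_gt0 dP].
apply/eqP/negPn/negP; rewrite -subr_eq0 => fg_neq0.
have dh : derivable (fun t => f t + (-1) * g t) 0 1.
  apply: (scalar_derivableD df); apply: (scalar_derivableM _ dg).
  exact: scalar_derivable_cst.
have /nbhs0_norm[e e_gt0 eP] : \forall t \near (0 : C), f t + (-1) * g t != 0.
  by apply: near_neq0 dh _; rewrite mulN1r.
pose m := Num.min d e / 2; have m_gt0 : 0 < m by rewrite divr_gt0 // lt_min d_gt0.
have nm : `|m%:C%C : C| = m%:C%C by rewrite gtr0_norm ?realC_gt0.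
have := eP m%:C%C; rewrite (dP m%:C%C) ?nm ?ltcR.
- by rewrite mulN1r subrr eqxx => /(_ _)/negP; apply=> //; rewrite /m minEle; case: ifP => *; lra.
- by rewrite /m minEle; case: ifP => *; lra.
by rewrite lt0r_neq0 // realC_gt0.
Qed.

(* phi may be arbitrary at isolated points; the local representatives H q fill
   them in and define a holomorphic function on P1. *)
Lemma P1_glue_const (phi : P1 R -> C) (H : P1 R -> C -> C) :
  (forall q, holomorphic_at0 (H q)) ->
  (forall q, \forall t \near (0 : C)^', phi (local_param q t) = H q t) ->
  forall q q', H q 0 = H q' 0.
Proof.
move=> hH phiH.
apply: (@P1_holomorphic_const R (fun q => H q 0)) => q.
apply: (scalar_derivable_eq (g := H q)); last exact: holomorphic_at0_derivable.
have [d1 d1_gt0 d1P] := dnbhs0_norm (phiH q).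
have [d2 d2_gt0 d2P] := nbhs0_norm (hH q).
pose d := Num.min d1 d2.
have d_gt0 : 0 < d by rewrite lt_min d1_gt0.
apply/(@nbhs_ballP C C (0 : C)); exists (d%:C%C : C) => /=; first by rewrite realC_gt0.
move=> t; rewrite -ball_normE /= sub0r normrN => td.
have dP (t' : C) : `|t'| < d%:C%C -> `|t'| < d1%:C%C /\ `|t'| < d2%:C%C.
  by move=> t'd; split; apply: lt_le_trans t'd _; rewrite lecR ge_min lexx ?orbT.
have [->|t_neq0] := eqVneq t 0.
  by rewrite (_ : local_param q 0 = q) //; case: (q) => [z|] /=; rewrite ?addr0 ?eqxx.
(* [tr] is the change of parameter from the chart centred at [local_param q t] to the one centred at
   [q]. Near 0 it stays nonzero and inside the disc where [phi] agrees with [H q], so both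
   representatives agree off 0, hence at 0. *)
suff [tr [dtr tr0 trP]] : exists tr : C -> C, [/\ derivable tr 0 1, tr 0 = t &
    \forall s \near (0 : C), local_param (local_param q t) s = local_param q (tr s)].
  rewrite -tr0; apply: (punctured_eq (f := H (local_param q (tr 0))) (g := H q \o tr)).
  - exact: holomorphic_at0_derivable.
  - by apply: (scalar_derivable_comp dtr); rewrite tr0; apply: d2P; case: (dP _ td).
  have tr_neq0 : \forall s \near (0 : C), tr s != 0 by apply: near_neq0; rewrite ?tr0.
  have tr_lt : \forall s \near (0 : C), `|tr s| < d%:C%C.
    by apply: near_norm_lt; rewrite ?tr0.
  rewrite near_withinE tr0; move: (phiH (local_param q t)); rewrite near_withinE.
  apply: near_and (near_and (fun s h1 h2 => conj h1 h2) trP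
    (near_and (fun s h1 h2 => conj h1 h2) tr_neq0 tr_lt)).
  move=> s [trE [trn trl]] + s_neq0 => /(_ s_neq0) <-.
  by rewrite trE; apply: d1P => //; case: (dP _ trl).
case: q {phiH d1P d2P} => [z|] /=; [exists (fun s => t + 1 * s) | exists (fun s => (t^-1 + 1 * s)^-1)].
- split; [exact: scalar_derivable_affine | by rewrite mulr0 addr0 |].
  by apply: near_all => s; rewrite mul1r addrA.
rewrite (negPf t_neq0); split.
- apply: (scalar_derivable_comp (f := GRing.inv) (g := fun s => t^-1 + 1 * s)).
    exact: scalar_derivable_affine.
  by apply: scalar_derivable_inv; rewrite mulr0 addr0 invr_neq0.
- by rewrite mulr0 addr0 invrK.
have : \forall s \near (0 : C), t^-1 + 1 * s != 0.
  apply: near_neq0; first exact: scalar_derivable_affine.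
  by rewrite mulr0 addr0 invr_neq0.
by apply: near_and (near_all _ (fun=> I)) => s _ s_neq0; rewrite invr_eq0 (negPf s_neq0) invrK mul1r.
Qed.
End Holomorphic.

(** * Subbundles of nonnegative degree are constant *)

Section Degree.
Variable R : realType.
Local Notation C := (CC R).

Lemma finite_support_sum (ord : P1 R -> int) :
  finite_set [set q | ord q != 0] ->
  exists2 E : seq (P1 R), uniq E & (forall q, q \notin E -> ord q = 0) /\
    \sum_(q \in [set: P1 R]) ord q = \sum_(q <- E) ord q.
Proof.
move=> fin; exists (finmap.enum_fset (fset_set [set q | ord q != 0])).
  exact: finmap.fset_uniq.
have out q : q \notin finmap.enum_fset (fset_set [set q | ord q != 0]) -> ord q = 0.
  move=> qE; apply/eqP; apply: contraNT qE => nz.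
  by rewrite in_fset_set // inE.
split=> //; rewrite (fsbigE _ _ (finmap.fset_uniq (fset_set [set q | ord q != 0]))) //.
- by apply: eq_bigl => q; rewrite in_setT.
- by move=> q _ /out.
Qed.

Section Normalizer.
Variables (E : seq (P1 R)) (ord : P1 R -> int).
Hypotheses (E_uniq : uniq E) (ord_out : forall q, q \notin E -> ord q = 0).

(* The scalar rational function with divisor - ord on the affine line. *)
Definition normalizer_factor (q x : P1 R) : C :=
  match q, x with Some w, Some z => (z - w) ^ (- ord q) | _, _ => 1 end.

Definition normalizer (x : P1 R) : C := \prod_(q <- E) normalizer_factor q x.

(** The factor at [Some z] gives the power of [t], and the other factors do not vanish at [z]. If
    [Some z] is not in [E], its order is 0 and the power is trivial. *)
Lemma normalizer_finite z : exists k : C -> C,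
  [/\ holomorphic_at0 k, k 0 != 0 &
      forall t, t != 0 -> normalizer (Some (z + t)) = t ^ (- ord (Some z)) * k t].
Proof.
pose k (t : C) := \prod_(q <- E | q != Some z) normalizer_factor q (Some (z + t)).
have fac_neq0 q : q != Some z -> normalizer_factor q (Some (z + 0)) != 0.
  case: q => [w|] wz; last exact: oner_neq0.
  by rewrite /= expfz_neq0 // addr0 subr_eq0 eq_sym; apply: contraNneq wz => ->.
exists k; split.
- apply: holomorphic_at0_prod => -[w|] wz; last exact: holomorphic_at0_cst.
  have -> : (fun t => normalizer_factor (Some w) (Some (z + t))) =
            (fun t => (z - w + 1 * t) ^ (- ord (Some w))).
    by apply/funext => t /=; rewrite mul1r addrAC.
  apply: holomorphic_at0_exprz; first exact: holomorphic_at0_affine.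
  by rewrite mulr0 addr0 subr_eq0 eq_sym; apply: contraNneq wz => ->.
- by rewrite prodf_seq_neq0; apply/allP => q _; apply/implyP => /fac_neq0.
move=> t t_neq0; rewrite /normalizer; have [zE|zE] := boolP (Some z \in E).
  by rewrite (bigD1_seq (Some z)) //= addrAC subrr add0r.
rewrite ord_out // oppr0 expr0z mul1r /k big_seq_cond [RHS]big_seq_cond.
by apply: eq_bigl => q; case: eqVneq => [->|]; rewrite ?(negPf zE) ?andbF ?andbT.
Qed.

(** Each finite factor satisfies [(t^-1 - w) ^ (- n) = t ^ n * (1 - w * t) ^ (- n)]; with the order
    at infinity, the powers of [t] add up to the degree. *)
Lemma normalizer_infinity : exists k : C -> C,
  [/\ holomorphic_at0 k, k 0 != 0 &
      forall t, t != 0 -> t ^ ord None * normalizer (Some t^-1) =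
                          t ^ (\sum_(q <- E) ord q) * k t].
Proof.
pose fac (q : P1 R) (t : C) : C :=
  if q is Some w then (1 + (- w) * t) ^ (- ord q) else 1.
exists (fun t => \prod_(q <- E) fac q t); split.
- apply: holomorphic_at0_prod => -[w|] _; last exact: holomorphic_at0_cst.
  apply: holomorphic_at0_exprz; first exact: holomorphic_at0_affine.
  by rewrite mulr0 addr0 oner_neq0.
- rewrite prodf_seq_neq0; apply/allP => -[w|] _ /=; last exact: oner_neq0.
  by rewrite mulr0 addr0 expfz_neq0 // oner_neq0.
move=> t t_neq0.
have -> : t ^ (\sum_(q <- E) ord q) = \prod_(q <- E) t ^ ord q.
  by elim: (E) => [|q s IHs]; rewrite ?big_nil ?expr0z // !big_cons expfzDr // IHs.
have -> : normalizer (Some t^-1) =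
    \prod_(q <- E) ((if q is Some w then t ^ ord q else 1) * fac q t).
  apply: eq_bigr => -[w|] _ /=; last by rewrite mulr1.
  have -> : t^-1 - w = t^-1 * (1 + (- w) * t) by rewrite mulrDr mulr1 mulrCA mulVf ?mulr1.
  by rewrite expfzMl exprz_inv opprK.
rewrite big_split /= mulrA; congr (_ * _).
have [nE|nE] := boolP (None \in E).
  rewrite (bigD1_seq None) //= [RHS](bigD1_seq None) //= mul1r.
  by congr (_ * _); apply: eq_bigr => -[].
rewrite ord_out // expr0z mul1r; apply: eq_big_seq => -[w|] //.
by move=> nE'; rewrite nE' in nE.
Qed.

End Normalizer.

(** By multiplicativity of determinants, each maximal minor of [M] is the corresponding minor of the
    local frame times [\det (g q t)]. Hence one scalar normalizer makes all of them holomorphic at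
    once. *)
Lemma degree_ge0_trivial r s (S : P1 R -> {vspace 'cV[C]_r}) d :
  holomorphic_subbundle s S -> has_degree s S d -> 0 <= d ->
  d = 0 /\ forall q q', S q = S q'.
Proof.
move=> [dimS _] [M [ord [frame_ord fin ->]]].
have [E E_uniq [ord_out ->]] := finite_support_sum fin.
clear d; set d := \sum_(q <- E) ord q => d_ge0.
have [N /choice[g gP]] := choice frame_ord.
have N_hol q i j : holomorphic_at0 (fun t => N q t i j).
  by case: (gP q) => -[].
have N_span q : colspan (N q 0) = S q.
  case: (gP q) => -[_ /(nbhs_singleton (p := (0 : C)))] + _ _ _ => /= ->.
  by case: (q) => [z|] /=; rewrite ?addr0 ?eqxx.
pose nrm := normalizer E ord.
(* [W] fills in the normalized transition determinant at [q]: a unit at finite points, [t ^ d] times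
   a unit at infinity. The latter is holomorphic because [d] is nonnegative, and vanishes at 0 if
   [d] is positive. *)
have W_ex q : exists W : C -> C, [/\ holomorphic_at0 W,
    \forall t \near (0 : C)^', \det (g q t) * nrm (local_param q t) = W t,
    q != None -> W 0 != 0 & q = None -> 0 < d -> W 0 = 0].
  have [_ _ _ [u [u_hol [u0 det_g]]]] := gP q.
  move: det_g; rewrite near_withinE => det_g.
  case: q u_hol u0 det_g => [z|] u_hol u0 det_g.
    have [k [k_hol k0 kE]] := normalizer_finite E_uniq ord_out z.
    exists (fun t => u t * k t); split.
    - exact: holomorphic_at0M u_hol k_hol.
    - rewrite near_withinE; move: det_g.
      apply: near_and (near_all _ (fun=> Logic.I)) => t _ gE t_neq0.
      rewrite gE // /nrm /= kE // -mulrA [t ^ _ * (_ * _)]mulrA -expfzDr //.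
      by rewrite addrN expr0z mul1r.
    - by rewrite mulf_neq0.
    by [].
  have [k [k_hol k0 kE]] := normalizer_infinity E_uniq ord_out.
  exists (fun t => u t * (t ^+ `|d|%N * k t)); split.
  - apply: (holomorphic_at0M u_hol); apply: (holomorphic_at0M _ k_hol).
    by apply: holomorphic_at0X; exact: holomorphic_at0_id.
  - rewrite near_withinE; move: det_g.
    apply: near_and (near_all _ (fun=> Logic.I)) => t _ gE t_neq0.
    by rewrite gE // /nrm /= (negPf t_neq0) -mulrA kE // -/d -[in LHS](gez0_abs d_ge0).
  - by [].
  by move=> _ d_gt0; rewrite expr0n absz_eq0 gt_eqF // mul0r mulr0.
have [W WP] := choice W_ex.
(* Local representatives of the normalized Pluecker coordinates, one for each choice [f] of rows. *)
pose H (f : {ffun 'I_s -> 'I_r}) q t := \det (rowsub f (N q t)) * W q t.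
have H_const f q q' : H f q 0 = H f q' 0.
  apply: (P1_glue_const (phi := fun q => \det (rowsub f (M q)) * nrm q)) => {q q'} q.
    have [W_hol _ _ _] := WP q; apply: (holomorphic_at0M _ W_hol).
    by apply: holomorphic_at0_det => i j; under eq_fun do rewrite mxE; exact: N_hol.
  have [_ WE _ _] := WP q; have [_ _ ME _] := gP q; move: WE ME.
  rewrite !near_withinE; apply: near_and => t WE ME t_neq0.
  by rewrite /H -WE // ME // -mul_rowsub_mx det_mulmx mulrA.
have N_full q : row_full (N q 0) by apply: dim_colspan_row_full; rewrite N_span.
(* Rows whose minor is nonzero at one finite point. By constancy [H f0] is nonzero everywhere, so
   [W None 0] is nonzero, which excludes [d > 0]. *)
pose f0 := fullrankfun (N_full (Some 0)).
have H0_neq0 q : H f0 q 0 != 0.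
  rewrite (H_const _ _ (Some 0)); apply: mulf_neq0; last by have [_ _ ->] := WP (Some 0).
  by have := fullrowsub_unit (N_full (Some 0)); rewrite unitmxE unitfE.
have det_W_neq0 q : \det (rowsub f0 (N q 0)) != 0 /\ W q 0 != 0.
  by have := H0_neq0 q; rewrite mulf_eq0 negb_or => /andP.
split.
  apply/eqP; rewrite eq_le d_ge0 andbT leNgt; apply/negP => d_gt0.
  have [_ _ _ /(_ erefl d_gt0)] := WP None.
  by have [_ /eqP] := det_W_neq0 None.
(* Built from constant Pluecker coordinates, [P] does not depend on [q]; yet it equals [N q 0] times
   an invertible matrix, up to a nonzero scalar, so it spans every fibre. *)
pose P := \matrix_(a < r, b < s)
  H [ffun k => if k == b then a else f0 k] (Some 0) 0.
suff SP q : S q = colspan P by move=> q q'; rewrite !SP.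
have [det_neq0 W_neq0] := det_W_neq0 q.
have -> : P = W q 0 *: (N q 0 *m \adj (rowsub f0 (N q 0))).
  apply/matrixP => a b; rewrite [LHS]mxE (H_const _ _ q) [RHS]mxE mulmx_adj_rowsub.
  rewrite /H mulrC; congr (_ * \det _).
  by apply/matrixP => i j; rewrite !mxE ffunE.
have adj_unit : \adj (rowsub f0 (N q 0)) \in unitmx.
  have : rowsub f0 (N q 0) *m \adj (rowsub f0 (N q 0)) \in unitmx.
    by rewrite mul_mx_adj unitmxE det_scalar unitrX // unitfE.
  by rewrite unitmx_mul => /andP[].
by rewrite (colspan_scale _ W_neq0) (colspan_mulmx_unit _ adj_unit) N_span.
Qed.
End Degree.

(** * Representations and parabolic degree *)

Section CastMx.
Variable K : fieldType.

Lemma mul_castmx_l m n p q (e : m = n) (X : 'M[K]_(m, p)) (Y : 'M[K]_(p, q)) :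
  castmx (e, erefl) X *m Y = castmx (e, erefl) (X *m Y).
Proof. by case: n / e. Qed.

Lemma mul_castmx_mid m n p q (e : m = n) (X : 'M[K]_(p, m)) (Y : 'M[K]_(m, q)) :
  castmx (erefl, e) X *m castmx (e, erefl) Y = X *m Y.
Proof. by case: n / e. Qed.

Lemma castmxD m n p (e : m = n) (X Y : 'M[K]_(m, p)) :
  castmx (e, erefl) (X + Y) = castmx (e, erefl) X + castmx (e, erefl) Y.
Proof. by case: n / e. Qed.

Lemma castmxZ m n p (e : m = n) a (X : 'M[K]_(m, p)) :
  castmx (e, erefl) (a *: X) = a *: castmx (e, erefl) X.
Proof. by case: n / e. Qed.
End CastMx.

(** * Path maps along the legs and preimage subrepresentations *)

Section Paths.
Variables (R : realType) (Q : star_quiver) (A : doubled_rep R Q).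
Local Notation C := (CC R).
Implicit Types (i : 'I_(nlegs Q)) (k j : nat).

Lemma xpath_id i k : xpath A i k k = 1%:M.
Proof. by case: k => [|k] /=; rewrite ?ltnn pid_mx_1. Qed.

(** [xpath] grows at the end nearer the centre; this peels off the map at the outer end. *)
Lemma xpath_xmap i k j : (k < j)%N ->
  xpath A i k.+1 j *m xmap A i k = xpath A i k j.
Proof.
elim: j => [//|j IHj]; rewrite ltnS leq_eqVlt => /predU1P[->|kj].
  by rewrite xpath_id mul1mx /= leqnn xpath_id mulmx1.
by rewrite /= kj (ltnW kj) -mulmxA IHj.
Qed.

(* The moment map equations let x y slide down a leg, up to scalars. *)
Lemma xpath_slide tau i k j : moment_level A tau -> (k <= j <= len i)%N ->
  exists c : C, (xmap A i j *m ymap A i j) *m xpath A i k.+1 j.+1 =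
    xpath A i k.+1 j.+1 *m (xmap A i k *m ymap A i k) + c *: xpath A i k.+1 j.+1.
Proof.
move=> [_ moment]; elim: j => [|j IHj] /andP[kj jl].
  move: kj; rewrite leqn0 => /eqP ->; exists 0.
  by rewrite xpath_id mulmx1 mul1mx scale0r addr0.
move: kj; rewrite leq_eqVlt => /predU1P[->|kj].
  by exists 0; rewrite xpath_id mulmx1 mul1mx scale0r addr0.
have [|c cP] := IHj; first by rewrite -ltnS kj ltnW.
have yx : ymap A i j.+1 *m xmap A i j.+1 =
    xmap A i j *m ymap A i j + (tau i j.+1)%:M.
  by rewrite -(moment i j jl) subrKC.
exists (c + tau i j.+1).
have -> : xpath A i k.+1 j.+2 = xmap A i j.+1 *m xpath A i k.+1 j.+1.
  by rewrite [LHS]/= kj.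
rewrite -!mulmxA [ymap A i j.+1 *m _]mulmxA yx mulmxDl cP mul_scalar_mx.
by rewrite !mulmxDr -!scalemxAr scalerDl addrA.
Qed.

Lemma xcompE i k : (k <= len i)%N ->
  xcomp A i k = castmx (rdim_top i, erefl) (xpath A i k (len i).+1).
Proof. by move=> kl; rewrite /xcomp /xstar mul_castmx_l /= kl. Qed.

Lemma xcomp_xmap i k : (k < len i)%N -> xcomp A i k.+1 *m xmap A i k = xcomp A i k.
Proof. by move=> kl; rewrite /xcomp -mulmxA xpath_xmap. Qed.

Lemma xcomp_len i : xcomp A i (len i) = xstar A i.
Proof. by rewrite /xcomp xpath_id mulmx1. Qed.

(** Sliding [x y] from node [k] to the centre. This makes the preimages of an invariant subspace
    stable under the maps [ymap]. *)
Lemma xcomp_ymap tau i k : moment_level A tau -> (k < len i)%N ->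
  exists c : C, xcomp A i k *m ymap A i k =
    xstar A i *m ystar A i *m xcomp A i k.+1 + c *: xcomp A i k.+1.
Proof.
move=> moment kl; have [|c cP] := @xpath_slide tau i k (len i) moment.
  by rewrite (ltnW kl) leqnn.
exists (- c); rewrite !xcompE // ?(ltnW kl) // /xstar /ystar -mulmxA mul_castmx_mid.
rewrite !mul_castmx_l -castmxZ -castmxD mulmxA cP scaleNr addrK.
by rewrite -[in LHS]xpath_xmap ?mulmxA // ltnS ltnW.
Qed.

Definition preimage_subrep (V : {vspace 'cV[C]_(rstar Q)}) : subspaces R Q :=
  Subspaces V (fun i k => linfun (mulmx (xcomp A i k) : 'cV_(rdim i k) -> 'cV_(rstar Q)) @^-1: V)%VS.

Lemma mem_preimage_node V i k v :
  (v \in sub_node (preimage_subrep V) i k) = (xcomp A i k *m v \in V).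
Proof. by rewrite -memv_preim lfunE. Qed.

Lemma is_subrep_preimage tau (V : {vspace 'cV[C]_(rstar Q)}) :
  moment_level A tau ->
  (forall i, maps_into (residue_of A i) V V) -> is_subrep A (preimage_subrep V).
Proof.
move=> moment resV.
(* The residue differs from [xstar A i *m ystar A i] by a scalar matrix only. *)
have xyV i : maps_into (xstar A i *m ystar A i) V V.
  move=> v vV; have := rpredD (resV i v vV) (rpredZ (\tr (xstar A i *m ystar A i) / (rstar Q)%:R) vV).
  by rewrite /residue_of /traceless_part mulmxBl mul_scalar_mx subrK.
split=> [i k /andP[k_gt0 kl]|i]; split=> v.
- by rewrite !mem_preimage_node mulmxA xcomp_xmap.
- rewrite !mem_preimage_node => vV.
  have [c cP] := xcomp_ymap moment kl.
  rewrite mulmxA cP mulmxDl -scalemxAl -[_ *m _ *m v]mulmxA.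
  by apply: rpredD; [exact: xyV | exact: rpredZ].
- by rewrite mem_preimage_node xcomp_len.
by move=> vV; rewrite mem_preimage_node xcomp_len mulmxA; exact: xyV.
Qed.

(** [xcomp A i k] maps the preimage of [V] onto the intersection of [V] with its image. *)
Lemma dim_preimage_node V i k :
  (\dim (V :&: colspan (xcomp A i k)) <= \dim (sub_node (preimage_subrep V) i k))%N.
Proof.
rewrite /= -lpreim_cap_limg; set f := linfun _.
rewrite -[X in (\dim X <= _)%N](lpreimK (f := f)) ?capvSr //.
by rewrite -[leqRHS](limg_ker_dim f) leq_addl.
Qed.

Section Stable.
Variables (beta : 'I_(nlegs Q) -> nat -> R) (tau : 'I_(nlegs Q) -> nat -> C).
Hypotheses (beta_gt0 : forall i k, (0 < k <= len i)%N -> 0 < beta i k).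
Hypotheses (moment : moment_level A tau) (stable : beta_stable A beta).

(** The kernels of the [xcomp] maps form the preimage of 0. Its central part is zero, so
    [beta_tilde] is nonnegative on it, and stability forces the kernels to vanish. *)
Lemma stable_dim_flag i k : (0 < rstar Q)%N -> (0 < k <= len i)%N ->
  \dim (colspan (xcomp A i k)) = rdim i k.
Proof.
move=> r_gt0 kl; set K := preimage_subrep 0.
have K_subrep : is_subrep A K.
  apply: (is_subrep_preimage moment) => j v; rewrite memv0 => /eqP ->.
  by rewrite mulmx0 mem0v.
suff K0 : sub_node K i k = 0%VS.
  rewrite /colspan; set f := linfun _.
  rewrite limg_dim_eq; first by rewrite dimvf /dim /= muln1.
  by rewrite capfv -lpreim0.
apply: contrapT => K_neq0.
have : beta_tilde beta K < 0.
  apply: stable => //; first by right; exists i, k.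
  by left => /(congr1 (fun V => \dim V)); rewrite dimv0 dimvf /dim /= muln1 => r0; rewrite -r0 in r_gt0.
apply/negP; rewrite -leNgt /beta_tilde dimv0 mul0r add0r.
apply: sumr_ge0 => j _; rewrite big_seq_cond; apply: sumr_ge0 => k'.
rewrite mem_index_iota andbT => /beta_gt0/ltW b_ge0.
by rewrite mulr_ge0.
Qed.

Lemma stable_invariant_lt0 (V : {vspace 'cV[C]_(rstar Q)}) :
  (0 < \dim V < rstar Q)%N -> (forall i, maps_into (residue_of A i) V V) ->
  (\dim V)%:R * beta_star beta + \sum_i \sum_(1 <= k < (len i).+1)
    (\dim (V :&: colspan (xcomp A i k)))%:R * beta i k < 0.
Proof.
move=> /andP[V_gt0 V_lt] resV.
have : beta_tilde beta (preimage_subrep V) < 0.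
  apply: stable; first exact: is_subrep_preimage moment resV.
    by left => /= V0; rewrite V0 dimv0 in V_gt0.
  by left => /= V1; rewrite V1 dimvf /dim /= muln1 ltnn in V_lt.
apply: le_lt_trans; rewrite /beta_tilde lerD2l.
apply: ler_sum => i _; rewrite big_seq_cond [leRHS]big_seq_cond; apply: ler_sum => k.
rewrite mem_index_iota andbT => /beta_gt0 b_gt0.
by rewrite ler_pM2r // ler_nat dim_preimage_node.
Qed.
End Stable.
End Paths.

Lemma sum_by_parts (F : fieldType) (a w : nat -> F) l : a 0 = 0 ->
  \sum_(1 <= k < l.+2) (a k - a k.-1) * w k =
  a l.+1 * w l.+1 + \sum_(1 <= k < l.+1) a k * (w k - w k.+1).
Proof.
move=> a0; elim: l => [|l IHl].
  by rewrite big_nat1 big_geq // a0 subr0 addr0.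
by rewrite big_nat_recr // IHl [in RHS]big_nat_recr //=; ring.
Qed.

(** * Parabolic degree through summation by parts *)

Section ParabolicDegree.
Variables (R : realType) (Q : star_quiver) (beta alpha : 'I_(nlegs Q) -> nat -> R).
Hypothesis alphaE : determined_weights beta alpha.

(** Summation by parts in the normalization of [alpha]. Summed over the legs, it says that the top
    weights add up to [beta_star]. *)
Lemma top_weight i : (rstar Q)%:R * alpha i (len i).+1 =
  - \sum_(1 <= k < (len i).+1) (rdim i k)%:R * beta i k.
Proof.
have [alphaB alpha0] := alphaE i; apply/eqP; rewrite -addr_eq0; apply/eqP.
rewrite -[RHS]alpha0; transitivity (\sum_(1 <= k < (len i).+2)
    ((rdim i k)%:R - (rdim i k.-1)%:R) * alpha i k).
  rewrite (sum_by_parts (a := fun k => (rdim i k)%:R)) ?rdim0 // rdim_top.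
  congr (_ + _); apply: eq_big_nat => k kl.
  by rewrite alphaB.
apply: eq_big_nat => -[//|k] /= kl.
by rewrite -natrB ?mulr_natl // ltnW // rdim_lt.
Qed.

Lemma pardeg_by_parts (a : 'I_(nlegs Q) -> nat -> nat) t : (0 < rstar Q)%N ->
  (forall i, a i 0 = 0) -> (forall i, a i (len i).+1 = t) ->
  \sum_i \sum_(1 <= k < (len i).+2) ((a i k)%:R - (a i k.-1)%:R) * alpha i k =
  t%:R * beta_star beta + \sum_i \sum_(1 <= k < (len i).+1) (a i k)%:R * beta i k.
Proof.
move=> r_gt0 a0 at_; rewrite /beta_star mulrN mulrA mulr_sumr -sumrN -big_split /=.
apply: eq_bigr => i _.
rewrite (sum_by_parts (a := fun k => (a i k)%:R)) ?a0 // at_; congr (_ + _).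
  rewrite -mulrN -mulrA -top_weight mulKf //.
  by rewrite pnatr_eq0 -lt0n.
by apply: eq_big_nat => k kl; rewrite (alphaE i).1.
Qed.
End ParabolicDegree.

Theorem theorem4p2p1 (R : realType) (Q : star_quiver)
  (p : 'I_(nlegs Q) -> CC R) (p_inj : injective p)
  (beta alpha : 'I_(nlegs Q) -> nat -> R)
  (tau sigma : 'I_(nlegs Q) -> nat -> CC R)
  (beta_gt0 : forall (i : 'I_(nlegs Q)) (k : nat),
     (0 < k <= len i)%N -> 0 < beta i k)
  (beta_small : \sum_i \sum_(1 <= k < (len i).+1) (rdim i k)%:R * beta i k < 1)
  (alphaE : determined_weights beta alpha)
  (sigmaE : determined_weights tau sigma)
  (alpha_bound : forall (i : 'I_(nlegs Q)) (k : nat),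
     (0 < k <= (len i).+1)%N -> - 2^-1 < alpha i k < 2^-1)
  (A : doubled_rep R Q) (A_moment : moment_level A tau)
  (A_stable : beta_stable A beta) :
  alpha_stable (higgs_of_rep p alpha A).
Proof.
move=> s S d /andP[s_gt0 s_lt] S_sub S_inv S_deg.
have r_gt0 : (0 < rstar Q)%N by apply: leq_ltn_trans s_lt.
have flagE i k : (0 < k <= len i)%N -> rep_flag A i k = colspan (xcomp A i k).
  by rewrite /rep_flag; case: k => [|k] //= ->.
have flag0 i : rep_flag A i 0 = 0%VS by [].
have flag_top i : rep_flag A i (len i).+1 = fullv by rewrite /rep_flag /= ltnn.
pose T := higgs_of_rep p alpha A.
pose B := \sum_i \sum_(1 <= k < (len i).+1) (rdim i k)%:R * beta i k.
have r_beta : (rstar Q)%:R * beta_star beta = - B.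
  by rewrite /beta_star mulrN mulVKf // pnatr_eq0 -lt0n.
have pardegE (s' : nat) (S' : P1 R -> {vspace 'cV[CC R]_(rstar Q)}) d' :
    (forall q, \dim (S' q) = s') -> pardeg (H := T) S' d' = d'%:~R +
      (s'%:R * beta_star beta + \sum_i \sum_(1 <= k < (len i).+1)
         (\dim (S' (Some (p i)) :&: colspan (xcomp A i k)))%:R * beta i k).
  move=> dimS'; rewrite /pardeg; congr (_ + _).
  rewrite (pardeg_by_parts alphaE (a := flag_dim (H := T) S') (t := s')) //.
  - congr (_ + _); apply: eq_bigr => i _; apply: eq_big_nat => k kl.
    by rewrite /flag_dim /= flagE.
  - by move=> i; rewrite /flag_dim /= flag0 capv0 dimv0.
  by move=> i; rewrite /flag_dim /= flag_top capvf.
have -> : slope (H := T) (fun=> fullv) 0 (rstar Q) = 0.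
  rewrite /slope (pardegE (rstar Q)); last by move=> _; rewrite dimvf /dim /= muln1.
  rewrite add0r r_beta (_ : \sum_i _ = B) ?addNr ?mul0r //.
  apply: eq_bigr => i _; apply: eq_big_nat => k kl.
  by rewrite capfv (stable_dim_flag beta_gt0 A_moment A_stable).
rewrite /slope ltr_pdivrMr ?ltr0n // mul0r.
have [dimS _] := S_sub; rewrite (pardegE s) //.
(* For negative degree, integrality gives [d <= -1]; [beta_star] is at most 0 and the flag terms are
   at most [B < 1], so invariance is not called upon. *)
have [d_ge0|d_lt0] := lerP 0 d; last first.
  have beta_star_le0 : s%:R * beta_star beta <= 0.
    rewrite mulr_ge0_le0 // -(pmulr_rle0 _ (x := (rstar Q)%:R)) ?ltr0n // r_beta oppr_le0.
    apply: sumr_ge0 => i _; rewrite big_seq_cond; apply: sumr_ge0 => k.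
    by rewrite mem_index_iota andbT => /beta_gt0/ltW b_ge0; rewrite mulr_ge0.
  have d_leN1 : d%:~R <= -1 :> R by rewrite -(mulrN1z 1) ler_int -ltzD1 addNr.
  have sum_le : \sum_i \sum_(1 <= k < (len i).+1)
      (\dim (S (Some (p i)) :&: colspan (xcomp A i k)))%:R * beta i k <= B.
    apply: ler_sum => i _; rewrite big_seq_cond [leRHS]big_seq_cond.
    apply: ler_sum => k; rewrite mem_index_iota andbT => /beta_gt0 b_gt0.
    rewrite ler_pM2r // ler_nat; apply: leq_trans (dimvS (capvSr _ _)) _.
    exact: dim_colspan_le.
  rewrite -/B in beta_small; lra.
have [-> S_const] := degree_ge0_trivial S_sub S_deg d_ge0.
rewrite add0r -(dimS None).
have resV i : maps_into (residue_of A i) (S None) (S None).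
  (* At [p i] the coefficient of every other residue contains the factor [p i - p i], while [c i] is
     nonzero because the points are distinct. The Higgs field there is thus a nonzero multiple of
     the residue at [p i]. *)
  pose c j : CC R := \prod_(k | k != j) (p i - p k).
  have c_i : c i != 0.
    rewrite prodf_seq_neq0; apply/allP => j _; apply/implyP => ji.
    by rewrite subr_eq0 (inj_eq p_inj) eq_sym.
  have c_j j : j != i -> c j = 0.
    by move=> ji; rewrite /c (bigD1 i) 1?eq_sym //= subrr mul0r.
  have valueE : higgs_value T (Some (p i)) = c i *: residue_of A i.
    transitivity (\sum_j c j *: residue_of A j) => //.
    rewrite (bigD1 i) //= big1 ?addr0 // => j /c_j ->.
    by rewrite scale0r.
  move=> v vS; have := S_inv (Some (p i)) v.
  rewrite -/T valueE (S_const (Some (p i)) None) => /(_ vS).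
  rewrite -scalemxAl => /(rpredZ (c i)^-1).
  by rewrite scalerA mulVf // scale1r.
have := stable_invariant_lt0 beta_gt0 A_moment A_stable _ resV.
rewrite dimS s_gt0 s_lt => /(_ isT); congr (_ + _ < 0).
by apply: eq_bigr => i _; apply: eq_bigr => k _; rewrite (S_const (Some (p i)) None).
Qed.
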